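(* Let $X$ be a real Banach space and let $A\subset\mathcal{B}(X)$ be a commutative algebra all of whose elements are essentially real operators. Then there is a closed subspace $L$ of $X^*$ with $\{0\}\neq L\neq X^*$ that is invariant for the algebra $A^*=\{T^*:T\in A\}$, i.e. $T^*L\subset L$ for all $T\in A$.
   Context: $\mathcal{B}(X)$ is the algebra of all bounded linear operators on $X$, $\mathcal{K}(X)$ is the ideal of compact operators, and $\|T\|_e=\inf\{\|T+K\|:K\in\mathcal{K}(X)\}$ is the essential norm, i.e. the norm of the image of $T$ in the Calkin algebra $\mathcal{B}(X)/\mathcal{K}(X)$. An operator $T\in\mathcal{B}(X)$ is essentially real if $\|1-\varepsilon T^2\|_e\le 1+o(\varepsilon)$ as $\varepsilon\searrow 0$, where $1$ is the identity operator. $T^*\in\mathcal{B}(X^* )$ is the adjoint of $T$. Algebras are real subalgebras of $\mathcal{B}(X)$, not assumed closed or unital. Complex Banach spaces are considered as real ones.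
   Formalization: The formal theorem adds that X has dimension at least 3: the claim fails in dimensions 0 and 1 (X* has no proper nonzero subspace) and in dimension 2 (the complex numbers acting on the real plane). *)

(* Defs.v *)
From HB Require Import structures.
From mathcomp Require Import all_boot all_order all_algebra.
From mathcomp Require Import all_classical all_reals all_analysis.

Set Implicit Arguments.
Unset Strict Implicit.
Unset Printing Implicit Defensive.

Import Order.TTheory GRing.Theory Num.Theory.
Import numFieldNormedType.Exports.

Local Open Scope classical_set_scope.
Local Open Scope ring_scope.

Section BoundedOperators.
Variables (R : realType) (X Y : normedModType R).

Definition is_bounded_linear (f : X -> Y) : Prop :=
  linear f /\ exists M : R, forall x, `|f x| <= M * `|x|.

Definition bounded_linear_pred : {pred (X -> Y)} :=
  fun f => `[< is_bounded_linear f >].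

(* Bounded linear operators, as a subtype of the module of all functions
   X -> Y, from which it inherits its pointwise module structure. *)
Record bop := Bop {
  bop_fun :> X -> Y;
  bop_funP : bop_fun \in bounded_linear_pred }.

HB.instance Definition _ := [isSub of bop for bop_fun].
HB.instance Definition _ := [Choice of bop by <:].

Lemma bounded_linear_submod : submod_closed bounded_linear_pred.
Proof.
split=> [|a f g /asboolP[lf [M fM]] /asboolP[lg [N gN]]]; apply/asboolP.
  split=> [b x y|]; first by rewrite /= scaler0 addr0.
  by exists 0 => x; rewrite normr0 mul0r.
split=> [b x y|].
  change (a *: f (b *: x + y) + g (b *: x + y) =
    b *: (a *: f x + g x) + (a *: f y + g y)).
  rewrite lf lg !scalerDr !scalerA (mulrC a b) -!addrA; congr (_ + _).
  by rewrite addrCA.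
exists (`|a| * M + N) => x.
change (`|a *: f x + g x| <= (`|a| * M + N) * `|x|).
rewrite (le_trans (ler_normD _ _))// normrZ mulrDl -mulrA.
by rewrite lerD// ler_wpM2l.
Qed.

HB.instance Definition _ := GRing.isSubmodClosed.Build R (X -> Y)%type
  bounded_linear_pred bounded_linear_submod.
HB.instance Definition _ := [SubChoice_isSubLmodule of bop by <:].

Lemma bop_linear (f : bop) : linear f.
Proof. by have /asboolP[] := bop_funP f. Qed.

HB.instance Definition _ (f : bop) :=
  GRing.isLinear.Build R X Y *:%R (bop_fun f) (bop_linear f).

Lemma bop_bounded (f : bop) : exists M : R, forall x, `|f x| <= M * `|x|.
Proof. by have /asboolP[] := bop_funP f. Qed.

Lemma bopP (f g : bop) : (forall x, f x = g x) -> f = g.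
Proof. by move=> fg; apply/val_inj/funext. Qed.

Definition op_norm (f : bop) : R := sup [set `|f x| | x in [set x | `|x| <= 1]].

Lemma op_norm_has_sup (f : bop) : has_sup [set `|f x| | x in [set x | `|x| <= 1]].
Proof.
split; first by exists `|f 0|; exists 0 => //=; rewrite normr0.
have [M fM] := bop_bounded f; exists `|M| => _ [x /= x1 <-].
rewrite (le_trans (fM x))// (le_trans (ler_norm _))// normrM normr_id.
by rewrite ler_piMr.
Qed.

Lemma op_norm_ball (f : bop) x : `|x| <= 1 -> `|f x| <= op_norm f.
Proof.
by move=> x1; apply: (sup_upper_bound (op_norm_has_sup f)); exists x.
Qed.

Lemma op_norm_ge0 (f : bop) : 0 <= op_norm f.
Proof. by rewrite (le_trans _ (@op_norm_ball f 0 _))// normr0. Qed.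

Lemma op_norm_le (f : bop) (M : R) :
  (forall x, `|x| <= 1 -> `|f x| <= M) -> op_norm f <= M.
Proof.
move=> fM; apply: ge_sup; first by have [] := op_norm_has_sup f.
by move=> _ [x /= x1 <-]; exact: fM.
Qed.

Lemma le_op_norm (f : bop) x : `|f x| <= op_norm f * `|x|.
Proof.
have [->|x0] := eqVneq x 0; first by rewrite linear0 !normr0 mulr0.
have nx0 : 0 < `|x| by rewrite normr_gt0.
rewrite -ler_pdivrMr// mulrC -[`|x|^-1]gtr0_norm ?invr_gt0//.
rewrite -normrZ -linearZ op_norm_ball// normrZ gtr0_norm ?invr_gt0//.
by rewrite mulVf ?gt_eqF.
Qed.

Lemma op_normD (f g : bop) : op_norm (f + g) <= op_norm f + op_norm g.
Proof.
apply: op_norm_le => x x1; change (`|f x + g x| <= op_norm f + op_norm g).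
by rewrite (le_trans (ler_normD _ _))// lerD// op_norm_ball.
Qed.

Lemma op_normZ (a : R) (f : bop) : op_norm (a *: f) = `|a| * op_norm f.
Proof.
have leZ b (g : bop) : op_norm (b *: g) <= `|b| * op_norm g.
  apply: op_norm_le => x x1; change (`|b *: g x| <= `|b| * op_norm g).
  by rewrite normrZ ler_wpM2l// op_norm_ball.
apply/eqP; rewrite eq_le leZ/=.
have [->|a0] := eqVneq a 0; first by rewrite normr0 mul0r op_norm_ge0.
rewrite -ler_pdivlMl ?normr_gt0// -normfV.
by rewrite -{1}[f](scalerK a0) leZ.
Qed.

Lemma op_norm0_eq0 (f : bop) : op_norm f = 0 -> f = 0.
Proof.
move=> f0; apply: bopP => x; change (f x = 0).
by apply/normr0_eq0/eqP; rewrite eq_le normr_ge0 (le_trans (le_op_norm f x))// f0 mul0r.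
Qed.

HB.instance Definition _ :=
  Lmodule_isNormed.Build R bop op_normD op_normZ op_norm0_eq0.

End BoundedOperators.

Section OperatorAlgebra.
Variables (R : realType) (X : normedModType R).

Lemma comp_bop_subproof (Y Z : normedModType R) (S : bop Y Z) (T : bop X Y) :
  S \o T \in @bounded_linear_pred R X Z.
Proof.
apply/asboolP; split=> [a x y|]; first by rewrite /= !linearP.
exists (op_norm S * op_norm T) => x /=.
by rewrite (le_trans (le_op_norm _ _))// -mulrA ler_wpM2l ?op_norm_ge0// le_op_norm.
Qed.

Definition comp_bop (Y Z : normedModType R) (S : bop Y Z) (T : bop X Y) :
  bop X Z := Bop (comp_bop_subproof S T).

Lemma id_bop_subproof : idfun \in @bounded_linear_pred R X X.
Proof. by apply/asboolP; split=> //; exists 1 => x; rewrite mul1r. Qed.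

Definition id_bop : bop X X := Bop id_bop_subproof.

Let comp_bopA : associative (fun S T : bop X X => comp_bop S T).
Proof. by move=> S T U; apply: bopP. Qed.
Let comp_id_bop : left_id id_bop (fun S T : bop X X => comp_bop S T).
Proof. by move=> S; apply: bopP. Qed.
Let comp_bop_id : right_id id_bop (fun S T : bop X X => comp_bop S T).
Proof. by move=> S; apply: bopP. Qed.
Let comp_bopDl : left_distributive (fun S T : bop X X => comp_bop S T) +%R.
Proof. by move=> S T U; apply: bopP. Qed.
Let comp_bopDr : right_distributive (fun S T : bop X X => comp_bop S T) +%R.
Proof. by move=> S T U; apply: bopP => x; exact: (linearD S). Qed.

(* Multiplication is composition and 1 is the identity operator; the ring may
   be trivial, since X may be zero. *)
HB.instance Definition _ := GRing.Zmodule_isPzRing.Build (bop X X)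
  comp_bopA comp_id_bop comp_bop_id comp_bopDl comp_bopDr.

Definition compact_op (K : bop X X) : Prop :=
  precompact (K @` [set x | `|x| <= 1]).

Definition ess_norm (T : bop X X) : R :=
  inf [set `|T + K| | K in [set K | compact_op K]].

Definition essentially_real (T : bop X X) : Prop :=
  exists2 r : R -> R, r =o_ (0^'+) id &
    \forall e \near 0^'+, ess_norm (1 - e *: T ^+ 2) <= 1 + r e.

(* The dual is the space of bounded functionals, with the operator norm; closed
   sets of the dual are closed for this norm. *)
Definition dual : normedModType R := bop X R^o.

(* Not required to be norm-closed or unital. *)
Definition commutative_algebra (A : set (bop X X)) : Prop :=
  [/\ A 0,
      forall (a : R) S T, A S -> A T -> A (a *: S + T),
      forall S T, A S -> A T -> A (S * T) &
      forall S T, A S -> A T -> S * T = T * S].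

End OperatorAlgebra.

Section Adjoint.
Variables (R : realType) (X : normedModType R) (T : bop X X).

Lemma adjoint_subproof :
  (fun f : dual X => comp_bop f T) \in @bounded_linear_pred R (dual X) (dual X).
Proof.
apply/asboolP; split=> [a f g|]; first exact: bopP.
exists (op_norm T) => f; apply: op_norm_le => x x1 /=.
rewrite (le_trans (le_op_norm _ _))// mulrC ler_wpM2r ?op_norm_ge0//.
exact: op_norm_ball.
Qed.

Definition adjoint : bop (dual X) (dual X) := Bop adjoint_subproof.

End Adjoint.

Section Subspaces.
Variables (R : realType) (V : normedModType R).

Definition closed_subspace (L : set V) : Prop :=
  [/\ closed L, L 0 & forall (a : R) u v, L u -> L v -> L (a *: u + v)].

(* V contains n linearly independent vectors. *)
Definition dim_ge (n : nat) : Prop :=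
  exists v : 'I_n -> V, forall a : 'I_n -> R,
    \sum_i a i *: v i = 0 -> forall i, a i = 0.

End Subspaces.
Arguments dim_ge {R} V n.

(* Main.v *)
Require Import Defs.
From mathcomp Require Import all_boot all_order all_algebra.
From mathcomp Require Import all_classical all_reals all_analysis.
From mathcomp Require Import complex ring lra.

(* Suppose that A^* has no nontrivial closed invariant subspace.  Hilden's
   iteration on a weak* compact ball avoiding 0 shows that for some y <> 0 the set
   W of all T^* y, with T in A + R 1 and |T|_e < 1, is not norm dense in X^*.  By
   the Bishop-Phelps theorem the closure of W has a support point w, with support
   functional x.  Since 1 - e S^2 has essential norm at most 1 + o(e), it maps W
   into (1 + o(e)) W, so that <x, S^2^* w> >= 0 for all S in A.  Hence the closed
   cone C of the z such that <x, b^2^* z> >= 0 for all b in A + R 1 is neither 0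
   nor X^*; it is invariant under S^2^* and, by Kaplansky's iteration of the
   Cauchy-Schwarz inequality, under (1 - e S^2)^* for small e > 0.  At a nonzero
   support point w' of C, with support functional x', both <x', S^2^* w'> and its
   opposite are nonnegative; polarising, x' annihilates all S^* T^* w', which
   yields an invariant subspace. *)

Set Implicit Arguments.
Unset Strict Implicit.
Unset Printing Implicit Defensive.

Import Order.TTheory GRing.Theory Num.Theory.
Import numFieldNormedType.Exports.

Local Open Scope classical_set_scope.
Local Open Scope ring_scope.

(** * Bounded operators *)

(** Hilden's iteration needs long products of operators of small essential norm to be small in norm,
    but even the powers of one such operator T may be large. Complex spectral theory would isolate
    eigenvalues; over the reals, limits of powers along an ultrafilter replace it. They exist
    because both ends of a high power are close to compact operators. If the powers of T do not tend
    to 0, these limits give a nonzero noninjective operator commuting with A, or place 1 at distance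
    less than 1 from a compact operator. In the latter case X has finite dimension, which needs a
    separate argument.

    A second support point is needed because the first gives only one sign of <x, S^2^* w>. At w'
    the functional x' vanishes, C being a cone, and this turns the invariance of C under (1 - e
    S^2)^* into the opposite sign. *)

Section BopTheory.
Variables (R : realType) (X Y : normedModType R).
Implicit Types f g : bop X Y.

Lemma ler_bop f x : `|f x| <= `|f| * `|x|.
Proof. exact: le_op_norm. Qed.

Lemma bop_norm_le f (M : R) : 0 <= M ->
  (forall x, `|f x| <= M * `|x|) -> `|f| <= M.
Proof.
move=> M0 fM; apply: op_norm_le => x x1; rewrite (le_trans (fM x))//.
by rewrite ler_piMr.
Qed.

Lemma bopDE f g x : (f + g) x = f x + g x. Proof. by []. Qed.
Lemma bopZE (a : R) f x : (a *: f) x = a *: f x. Proof. by []. Qed.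
Lemma bopNE f x : (- f) x = - f x. Proof. by []. Qed.
Lemma bopBE f g x : (f - g) x = f x - g x. Proof. by []. Qed.
Lemma bop0E x : (0 : bop X Y) x = 0. Proof. by []. Qed.

Lemma bop_exists (h : X -> Y) (M : R) : linear h ->
  (forall x, `|h x| <= M * `|x|) -> exists f : bop X Y, forall x, f x = h x.
Proof.
move=> lh hM.
have hP : h \in @bounded_linear_pred R X Y by apply/asboolP; split=> //; exists M.
by exists (Bop hP).
Qed.

End BopTheory.

Section BopRing.
Variables (R : realType) (X : normedModType R).
Implicit Types S T : bop X X.

Lemma bopME S T x : (S * T) x = S (T x). Proof. by []. Qed.
Lemma bop1E x : (1 : bop X X) x = x. Proof. by []. Qed.

Lemma bop_normM S T : `|S * T| <= `|S| * `|T|.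
Proof.
apply: bop_norm_le => [|x]; first by rewrite mulr_ge0.
by rewrite (le_trans (ler_bop S (T x)))// -mulrA ler_wpM2l// ler_bop.
Qed.

Lemma bop_norm1 : `|1 : bop X X| <= 1.
Proof. by apply: bop_norm_le => // x; rewrite mul1r. Qed.

Lemma bop_normX T n : `|T ^+ n| <= `|T| ^+ n.
Proof.
elim: n => [|n ih]; first by rewrite !expr0 bop_norm1.
by rewrite !exprS (le_trans (bop_normM _ _))// ler_wpM2l.
Qed.

Lemma bop_scaleAl (a : R) S T : a *: (S * T) = (a *: S) * T.
Proof. exact: bopP. Qed.

Lemma bop_scaleAr (a : R) S T : a *: (S * T) = S * (a *: T).
Proof. by apply: bopP => x; rewrite bopZE !bopME bopZE linearZ. Qed.

Lemma bop_exprZ (a : R) T n : (a *: T) ^+ n = a ^+ n *: T ^+ n.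
Proof.
elim: n => [|n ih]; first by rewrite !expr0 scale1r.
by rewrite !exprS ih -bop_scaleAl -bop_scaleAr scalerA.
Qed.

Implicit Types f g : dual X.

Lemma adjointE T f x : adjoint T f x = f (T x). Proof. by []. Qed.

Lemma adjointM S T f : adjoint (S * T) f = adjoint T (adjoint S f).
Proof. exact: bopP. Qed.

Lemma adjoint1 f : adjoint 1 f = f.
Proof. exact: bopP. Qed.

Lemma adjoint0 f : adjoint 0 f = 0.
Proof. by apply: bopP => x; rewrite adjointE !bop0E linear0. Qed.

Lemma adjointDl S T f : adjoint (S + T) f = adjoint S f + adjoint T f.
Proof. by apply: bopP => x; rewrite !(bopDE, adjointE) linearD. Qed.

Lemma adjointZl (a : R) T f : adjoint (a *: T) f = a *: adjoint T f.
Proof. by apply: bopP => x; rewrite !(bopZE, adjointE) linearZ. Qed.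

Lemma adjointNl T f : adjoint (- T) f = - adjoint T f.
Proof. by apply: bopP => x; rewrite !(bopNE, adjointE) linearN. Qed.

Lemma adjointBl S T f : adjoint (S - T) f = adjoint S f - adjoint T f.
Proof. by rewrite adjointDl adjointNl. Qed.

Lemma ler_adjoint T f : `|adjoint T f| <= `|T| * `|f|.
Proof.
apply: bop_norm_le => [|x]; first by rewrite mulr_ge0.
rewrite adjointE (le_trans (ler_bop f (T x)))// (mulrC `|T|) -mulrA ler_wpM2l//.
exact: ler_bop.
Qed.

End BopRing.

Section BopLimit.
Variables (R : realType) (X : normedModType R) (Y : completeNormedModType R).

(** Pointwise limits exist since Y is complete, and the Cauchy condition in operator norm makes the
    estimate uniform in x. Filters replace sequences so that the same statement yields completeness
    of the dual and limits along ultrafilters. *)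
Lemma bop_cauchy_lim (I : Type) (F : set_system I) (FF : ProperFilter F)
    (P : I -> bop X Y) :
  (forall e : R, 0 < e -> exists2 J : set I, F J &
     forall i j, J i -> J j -> `|P i - P j| <= e) ->
  exists Q : bop X Y, forall e : R, 0 < e -> F [set i | `|P i - Q| <= e].
Proof.
move=> PC.
have cv x : exists y : Y, P i x @[i --> F] --> y.
  apply/cvg_ex/cauchy_cvgP/cauchy_ballP => e e0.
  have [|J FJ PJ] := PC (e / (2 * (1 + `|x|))).
    by rewrite divr_gt0// mulr_gt0// ltr_wpDr.
  exists (((P ^~ x) @` J), ((P ^~ x) @` J)).
    by split; (change (F ((P ^~ x) @^-1` ((P ^~ x) @` J))); apply: filterS FJ => i Ji; exists i).
  move=> [_ _] /= [[i Ji <-] [j Jj <-]]; rewrite -ball_normE /ball_ /=.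
  change (`|(P i - P j) x| < e); rewrite (le_lt_trans (ler_bop _ _))//.
  have h : `|P i - P j| * `|x| <= e / (2 * (1 + `|x|)) * `|x|.
    by rewrite ler_wpM2r// PJ.
  rewrite (le_lt_trans h)// mulrAC ltr_pdivrMr ?mulr_gt0 ?ltr_wpDr//.
  by rewrite ltr_pM2l//; have := normr_ge0 x; lra.
have [q qP] := choice cv.
have ql : linear q.
  move=> a x y; have : P i (a *: x + y) @[i --> F] --> a *: q x + q y.
    rewrite (_ : (fun i => P i (a *: x + y)) = (fun i => a *: P i x + P i y)).
      by apply: cvgD => //; apply: cvgZl_tmp.
    by apply/funext => i; rewrite linearP.
  move=> h; exact: (norm_cvg_unique (qP (a *: x + y)) h).
have key e J i x : F J -> (forall i j, J i -> J j -> `|P i - P j| <= e) ->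
    J i -> `|P i x - q x| <= e * `|x|.
  move=> FJ PJ Ji; apply/ler_addgt0Pr => d d0.
  have /cvgrPdist_le/(_ _ d0) qd := qP x.
  have [j [Jj /= qj]] := filter_ex (filterI FJ qd).
  rewrite (_ : P i x - q x = (P i - P j) x - (q x - P j x)); last first.
    by rewrite bopBE opprB addrA subrK.
  rewrite (le_trans (ler_normB _ _))// lerD// (le_trans (ler_bop _ _))//.
  by rewrite ler_wpM2r// PJ.
have [J FJ PJ] := PC 1 ltr01.
have [i Ji] := filter_ex FJ.
have [Q QE] : exists Q : bop X Y, forall x, Q x = q x.
  apply: (@bop_exists _ _ _ _ (`|P i| + 1)) => // x.
  rewrite -[q x](subKr (P i x)) (le_trans (ler_normB _ _))// mulrDl lerD//.
    exact: ler_bop.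
  by rewrite (key 1 J).
exists Q => e e0; have [K FK PK] := PC e e0.
apply: (filterS _ FK) => j Kj /=; apply: bop_norm_le; first exact: ltW.
by move=> x; rewrite bopBE QE (key e K).
Qed.

End BopLimit.

(** * Compact operators *)

Section UltraCover.

(** Compactness without a topology: if no finite subfamily covers A, the parts of A missed by
    finitely many [N i] generate a proper filter, and an ultrafilter refining it contains no [N i].
    It serves for norm compact sets and for weak* compact balls alike. *)
Lemma ultra_cover (T : Type) (I : eqType) (A : set T) (N : I -> set T) :
  (forall U : set_system T, UltraFilter U -> U A -> exists i, U (N i)) ->
  exists s : seq I, forall t, A t -> exists2 i, i \in s & N i t.
Proof.
move=> UN; apply: contrapT => nos.
pose B (s : seq I) : set T := [set t | A t /\ forall i, i \in s -> ~ N i t].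
have FB : ProperFilter (filter_from setT B).
  apply: filter_from_proper; last first.
    move=> s _; apply: contrapT => B0; apply: nos; exists s => t At.
    apply: contrapT => nt; apply: B0; exists t; split=> // i si Nt.
    by apply: nt; exists i.
  apply: filter_fromT_filter; first by exists [::].
  move=> s1 s2; exists (s1 ++ s2) => t [At h]; split; split=> // i si;
    by apply: h; rewrite mem_cat si ?orbT.
have [U [UU BU]] := ultraFilterLemma FB.
have UA : U A by apply: BU; exists [::] => // t [].
have [i UNi] := UN U UU UA.
have UnN : U [set t | ~ N i t].
  by apply: BU; exists [:: i] => // t [_]; apply; rewrite inE.
by have [t [Nt nNt]] := filter_ex (filterI UNi UnN).
Qed.

Lemma ultra_finite_union (T : Type) (I : eqType) (U : set_system T)
    (UU : UltraFilter U) (s : seq I) (N : I -> set T) :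
  U [set t | exists2 i, i \in s & N i t] -> exists2 i, i \in s & U (N i).
Proof.
elim: s => [|i s ih] Us.
  by have [t [? ]] := filter_ex Us; rewrite in_nil.
have [Ui|Ui] := in_ultra_setVsetC (N i) UU.
  by exists i => //; rewrite mem_head.
have [j js Uj] : exists2 j, j \in s & U (N j).
  apply: ih; apply: filterS (filterI Us Ui) => t [[j + Nj] /= nNi].
  by rewrite inE => /orP[/eqP ji|js]; [rewrite ji in Nj|exists j].
by exists j => //; rewrite inE js orbT.
Qed.

Lemma filter_finite_inter (T : Type) (I : eqType) (F : set_system T)
    (FF : Filter F) (s : seq I) (J : I -> set T) :
  (forall i, i \in s -> F (J i)) -> F [set t | forall i, i \in s -> J i t].
Proof.
elim: s => [|i s ih] FJ.
  by apply: (filterS _ filterT) => t _ i; rewrite in_nil.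
have Fi : F (J i) by apply: FJ; rewrite mem_head.
have Fs : F [set t | forall i, i \in s -> J i t].
  by apply: ih => j js; apply: FJ; rewrite inE js orbT.
apply: filterS (filterI Fi Fs) => t [Ji Js] j.
by rewrite inE => /orP[/eqP ->//|]; exact: Js.
Qed.

End UltraCover.

Section CompactOperators.
Variables (R : realType) (X : normedModType R).
Implicit Types K S T : bop X X.

Lemma bop_continuous (Y : normedModType R) (f : bop X Y) : continuous f.
Proof.
move=> x; apply/cvgrPdist_lt => e e0.
have M0 : 0 < 1 + `|f| by rewrite ltr_wpDr.
near=> y; rewrite -linearB (le_lt_trans (ler_bop _ _))//.
have : `|x - y| < e / (1 + `|f|).
  by near: y; apply: cvgr_dist_lt => //; rewrite divr_gt0.
rewrite ltr_pdivlMr// => h; apply: le_lt_trans h; rewrite mulrC ler_wpM2l//.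
by rewrite lerDr.
Unshelve. all: by end_near. Qed.

Lemma compact_opP K : compact_op K <->
  exists2 C : set X, compact C & forall x, `|x| <= 1 -> C (K x).
Proof.
split=> [[C KC [cC _]]|[C cC KC]].
  by exists C => // x x1; apply: KC; exists x.
exists C; first by move=> _ [x x1 <-]; exact: KC.
by split=> //; apply: compact_closed => //; exact: norm_hausdorff.
Qed.

Lemma compact_op0 : compact_op (0 : bop X X).
Proof. by apply/compact_opP; exists [set 0] => //; exact: compact_set1. Qed.

Lemma compact_opD K L : compact_op K -> compact_op L -> compact_op (K + L).
Proof.
move=> /compact_opP[C cC KC] /compact_opP[D cD LD]; apply/compact_opP.
exists ((fun z : X * X => z.1 + z.2) @` (C `*` D)).
  apply: continuous_compact; last exact: compact_setX.
  by apply: continuous_subspaceT => z; exact: add_continuous.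
by move=> x x1; exists (K x, L x) => //; split; [exact: KC|exact: LD].
Qed.

Lemma compact_opMl S K : compact_op K -> compact_op (S * K).
Proof.
move=> /compact_opP[C cC KC]; apply/compact_opP; exists (S @` C).
  apply: continuous_compact cC.
  by apply: continuous_subspaceT; exact: bop_continuous.
by move=> x x1; exists (K x) => //; exact: KC.
Qed.

Lemma compact_opZ (a : R) K : compact_op K -> compact_op (a *: K).
Proof.
move=> cK; rewrite (_ : a *: K = (a *: (1 : bop X X)) * K); first exact: compact_opMl.
exact: bopP.
Qed.

Lemma compact_opMr S K : compact_op K -> compact_op (K * S).
Proof.
have M0 : 0 < 1 + `|S| by rewrite ltr_wpDr.
move=> /(@compact_opZ (1 + `|S|)) /compact_opP[C cC KC]; apply/compact_opP.
exists C => // x x1.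
rewrite (_ : (K * S) x = ((1 + `|S|) *: K) ((1 + `|S|)^-1 *: S x)).
  apply: KC; rewrite normrZ gtr0_norm ?invr_gt0// ler_pdivrMl// mulr1.
  rewrite (le_trans (ler_bop _ _))// (le_trans (ler_piMr _ x1))//.
  by rewrite lerDr.
by rewrite bopZE linearZ/= scalerA divff ?gt_eqF// scale1r.
Qed.

Lemma compact_op_net K (e : R) : compact_op K -> 0 < e ->
  exists s : seq X, forall x, `|x| <= 1 -> exists2 p, p \in s & `|K x - p| <= e.
Proof.
move=> /compact_opP[C cC KC] e0.
have [|s sC] := @ultra_cover X X C (fun p => [set y | `|y - p| <= e]).
  move=> U UU UC; move: cC; rewrite compact_ultra => /(_ U UU UC)[p [Cp Up]].
  exists p; have /cvgrPdist_le/(_ _ e0) := Up.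
  by apply: filterS => y; rewrite distrC.
by exists s => x x1; apply: sC; exact: KC.
Qed.

Lemma compact_op_cauchy (I : Type) (U : set_system I) (UU : UltraFilter U) K
    (v : I -> X) (M : R) : compact_op K -> U [set i | `|v i| <= M] ->
  forall e : R, 0 < e -> exists2 J : set I, U J &
    forall i j, J i -> J j -> `|K (v i) - K (v j)| <= e.
Proof.
move=> cK UM e e0; pose N := 1 + `|M|.
have N0 : 0 < N by rewrite ltr_wpDr.
have [//||s sK] := @compact_op_net (N *: K) (e / 2).
- exact: compact_opZ.
- by rewrite divr_gt0.
have [|p ps Up] := @ultra_finite_union I X U UU s
    (fun p => [set i | `|K (v i) - p| <= e / 2]).
  apply: filterS UM => i /= vM.
  have [|p ps Kp] := sK (N^-1 *: v i).
    rewrite normrZ gtr0_norm ?invr_gt0// ler_pdivrMl// mulr1.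
    by rewrite (le_trans vM)// /N (le_trans (ler_norm M))// lerDr.
  exists p => //; move: Kp; rewrite bopZE linearZ/= scalerA divff ?gt_eqF//.
  by rewrite scale1r.
exists [set i | `|K (v i) - p| <= e / 2] => // i j /= Ki Kj.
rewrite (_ : K (v i) - K (v j) = (K (v i) - p) - (K (v j) - p)); last first.
  by rewrite opprB addrA subrK.
by rewrite (le_trans (ler_normB _ _))// [leRHS](splitr e) lerD.
Qed.

(* Vala's theorem: S |-> K S L is a compact map when K and L are compact. *)
Lemma compact_op_sandwich_cauchy (I : Type) (U : set_system I)
    (UU : UltraFilter U) K L (S : I -> bop X X) (M : R) :
  compact_op K -> compact_op L -> U [set i | `|S i| <= M] ->
  forall e : R, 0 < e -> exists2 J : set I, U J &
    forall i j, J i -> J j -> `|K * S i * L - K * S j * L| <= e.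
Proof.
move=> cK cL UM e e0; pose N := 1 + `|M|.
have N0 : 0 < N by rewrite ltr_wpDr.
have K0 : 0 < 1 + `|K| by rewrite ltr_wpDr.
(* Replacing [L x] by a net point p costs at most (1 + |K|) N d = e / 3 for each of the two indices;
   the third e / 3 is for the difference at p. *)
pose d := e / (3 * (N * (1 + `|K|))).
have d0 : 0 < d by rewrite divr_gt0// !mulr_gt0.
have [s sL] := compact_op_net cL d0.
have UJ (p : X) : exists J : set I, U J /\
    forall i j, J i -> J j -> `|K (S i p) - K (S j p)| <= e / 3.
  have [||J UJ JK] := @compact_op_cauchy I U UU K (fun i => S i p) (M * `|p|)
      cK _ (e / 3).
  - apply: filterS UM => i /= SM.
    by rewrite (le_trans (ler_bop _ _))// ler_wpM2r.
  - by rewrite divr_gt0.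
  by exists J.
have [J JP] := choice UJ.
exists ([set i | `|S i| <= M] `&` [set i | forall p, p \in s -> J p i]).
  by apply: filterI => //; apply: filter_finite_inter => p _; have [] := JP p.
move=> i j [/= Mi Ji] [/= Mj Jj]; apply: op_norm_le => x x1.
have [p ps Lp] := sL x x1.
have KS k : `|S k| <= M -> `|K (S k (L x - p))| <= e / 3.
  move=> Mk; rewrite (le_trans (ler_bop _ _))//.
  have h1 : `|S k (L x - p)| <= N * d.
    rewrite (le_trans (ler_bop _ _))// ler_pM//.
    by rewrite (le_trans Mk)// /N (le_trans (ler_norm M))// lerDr.
  have -> : e / 3 = (1 + `|K|) * (N * d).
    by rewrite /d; field; rewrite !gt_eqF.
  by rewrite ler_pM// lerDr.
rewrite (_ : (K * S i * L - K * S j * L) x =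
  (K (S i (L x - p)) - K (S j (L x - p))) + (K (S i p) - K (S j p))); last first.
  rewrite bopBE !bopME (linearB (S i)) (linearB (S j)) !(linearB K) /=.
  by rewrite opprB addrACA subrK addrAC subrr sub0r.
rewrite (le_trans (ler_normD _ _))//.
rewrite (_ : e = (e / 3 + e / 3) + e / 3); last by field.
apply: lerD; last by have [_] := JP p; apply; [exact: Ji|exact: Jj].
by rewrite (le_trans (ler_normB _ _))// lerD ?KS.
Qed.

Definition ess_le (c : R) T := exists2 K, compact_op K & `|T - K| <= c.

Lemma ess_norm_lt (c : R) T : ess_norm T < c -> ess_le c T.
Proof.
move=> /inf_lt[|_ [K cK <-] TK]; first by exists `|T + 0|, 0 => //; exact: compact_op0.
exists (- 1 *: K); first exact: compact_opZ.
by rewrite scaleN1r opprK ltW.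
Qed.

Lemma ess_le_norm T : ess_le `|T| T.
Proof. by exists 0; [exact: compact_op0|rewrite subr0]. Qed.

Lemma ess_leW c d T : c <= d -> ess_le c T -> ess_le d T.
Proof. by move=> cd [K cK Kc]; exists K => //; exact: le_trans cd. Qed.

Lemma ess_leM c d S T : ess_le c S -> ess_le d T -> ess_le (c * d) (S * T).
Proof.
move=> [K cK Kc] [L cL Ld]; exists ((S - K) * L + K * T).
  by apply: compact_opD; [exact: compact_opMl|exact: compact_opMr].
rewrite (_ : S * T - _ = (S - K) * (T - L)).
  by rewrite (le_trans (bop_normM _ _))// ler_pM.
by rewrite mulrBr !mulrBl opprD addrA addrAC.
Qed.

Lemma ess_leX c T n : ess_le c T -> ess_le (c ^+ n) (T ^+ n).
Proof.
move=> Tc; elim: n => [|n ih]; last by rewrite !exprS; exact: ess_leM.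
by rewrite !expr0; apply: ess_leW (ess_le_norm _); exact: bop_norm1.
Qed.

Lemma ess_leD c d S T : ess_le c S -> ess_le d T -> ess_le (c + d) (S + T).
Proof.
move=> [K cK Kc] [L cL Ld]; exists (K + L); first exact: compact_opD.
by rewrite opprD addrACA (le_trans (ler_normD _ _))// lerD.
Qed.

Lemma ess_leZ (a : R) c T : ess_le c T -> ess_le (`|a| * c) (a *: T).
Proof.
move=> [K cK Kc]; exists (a *: K); first exact: compact_opZ.
by rewrite -scalerBr normrZ ler_wpM2l.
Qed.

End CompactOperators.

(** * The Hahn-Banach theorem *)

Section Sublinear.
Variables (R : realType) (V : lmodType R).
Implicit Types p q : V -> R.

Definition sublinear q : Prop :=
  (forall x y, q (x + y) <= q x + q y) /\
  forall (t : R) x, 0 <= t -> q (t *: x) = t * q x.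

Lemma sublinear0 q : sublinear q -> q 0 = 0.
Proof. by move=> [_ /(_ 0 0 (lexx 0))]; rewrite scale0r mul0r. Qed.

Lemma sublinear_ge q x : sublinear q -> - q (- x) <= q x.
Proof.
move=> sq; have [qD _] := sq.
by rewrite -subr_ge0 opprK -(sublinear0 sq) -{1}(subrr x) qD.
Qed.

Lemma sublinear_hom q : (forall x y, q (x + y) <= q x + q y) -> q 0 = 0 ->
  (forall (t : R) x, 0 < t -> q (t *: x) <= t * q x) -> sublinear q.
Proof.
move=> qD q0 qZ; split=> // t x; rewrite le_eqVlt => /predU1P[<-|t0].
  by rewrite scale0r mul0r.
apply/eqP; rewrite eq_le qZ//= -ler_pdivlMl//.
by rewrite -{1}[x](scalerK (lt0r_neq0 t0)) qZ// invr_gt0.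
Qed.

(* The witness is the infimum over t >= 0 of q (x + t a) - t q a; it shows that
   minimal sublinear functionals are odd, hence linear. *)
Lemma sublinear_shrink q a : sublinear q ->
  exists q', [/\ sublinear q', forall x, q' x <= q x & q' (- a) <= - q a].
Proof.
move=> sq; have [qD qZ] := sq.
pose E x : set R := [set q (x + t *: a) - t * q a | t in [set t | 0 <= t]].
pose q' x := inf (E x).
have lbE x : has_lbound (E x).
  exists (- q (- x)) => _ [t t0 <-].
  by have := qD (x + t *: a) (- x); rewrite addrAC subrr add0r qZ//; lra.
have leE x t : 0 <= t -> q' x <= q (x + t *: a) - t * q a.
  by move=> t0; apply: ge_inf => //; exists t.
have geE x c : (forall t, 0 <= t -> c <= q (x + t *: a) - t * q a) -> c <= q' x.
  move=> h; apply: lb_le_inf; first by exists (q (x + 0 *: a) - 0 * q a), 0 => /=.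
  by move=> _ [t t0 <-]; exact: h.
exists q'; split; last 2 first.
- by move=> x; have := leE x 0 (lexx 0); rewrite scale0r addr0 mul0r subr0.
- by have := leE (- a) 1 ler01; rewrite scale1r addNr (sublinear0 sq) mul1r sub0r.
apply: sublinear_hom => [x y||t x t0].
- rewrite -lerBlDr; apply: (geE) => t t0; rewrite lerBlDr -lerBlDl.
  apply: (geE) => s s0; rewrite lerBlDl.
  have := leE (x + y) _ (addr_ge0 t0 s0); rewrite scalerDl addrACA => h.
  by have := qD (x + t *: a) (y + s *: a); lra.
- apply/eqP; rewrite eq_le; apply/andP; split.
    by have := leE 0 0 (lexx 0); rewrite scale0r addr0 mul0r subr0 (sublinear0 sq).
  by apply: (geE) => t t0; rewrite add0r qZ// subrr.
- rewrite -ler_pdivrMl//; apply: (geE) => s s0; rewrite ler_pdivrMl//.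
  have := leE (t *: x) _ (mulr_ge0 (ltW t0) s0); rewrite -scalerA -scalerDr.
  by rewrite (qZ _ _ (ltW t0)); lra.
Qed.

(** Zorn's lemma: the infimum of a chain is finite because every member is at least -p(-x), and
    subadditive because two members of the chain are comparable. *)
Lemma minimal_sublinear p : sublinear p -> exists q, [/\ sublinear q,
  forall x, q x <= p x &
  forall q', sublinear q' -> (forall x, q' x <= q x) -> forall x, q x <= q' x].
Proof.
move=> sp.
pose T := {q : V -> R | sublinear q /\ forall x, q x <= p x}.
pose Rel (q q' : T) := `[< forall x, sval q' x <= sval q x >].
have Tp : sublinear p /\ forall x, p x <= p x by [].
have [||A totA|q qmin] := @ZL_preorder T (exist _ p Tp) Rel.
- by move=> q; apply/asboolP.
- move=> q q' q'' /asboolP h1 /asboolP h2; apply/asboolP => x.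
  exact: le_trans (h2 x) (h1 x).
- have [[q0 Aq0]|A0] := pselect (A !=set0); last first.
    by exists (exist _ p Tp) => q Aq; case: A0; exists q.
  pose E x : set R := [set sval (q : T) x | q in A].
  pose m x := inf (E x).
  have lbE x : has_lbound (E x).
    exists (- p (- x)) => _ [q _ <-]; have [sq qp] := svalP q.
    by rewrite (le_trans _ (sublinear_ge x sq))// lerN2.
  have leE x (q : T) : A q -> m x <= sval q x.
    by move=> Aq; apply: ge_inf => //; exists q.
  have geE x c : (forall q : T, A q -> c <= sval q x) -> c <= m x.
    move=> h; apply: lb_le_inf; first by exists (sval q0 x), q0.
    by move=> _ [q Aq <-]; exact: h.
  have sm : sublinear m.
    apply: sublinear_hom => [x y||t x t0].
    + rewrite -lerBlDr; apply: (geE) => q Aq; rewrite lerBlDr -lerBlDl.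
      apply: (geE) => q' Aq'; rewrite lerBlDl.
      have [[qD _] _] := svalP q; have [[q'D _] _] := svalP q'.
      have [/asboolP qq'|/asboolP qq'] := totA q q' Aq Aq'.
        by rewrite (le_trans (leE _ _ Aq'))// (le_trans (q'D _ _))// lerD.
      by rewrite (le_trans (leE _ _ Aq))// (le_trans (qD _ _))// lerD.
    + apply/eqP; rewrite eq_le; apply/andP; split.
        have [sq _] := svalP q0.
        by rewrite (le_trans (leE _ _ Aq0))// (sublinear0 sq).
      by apply: (geE) => q _; have [sq _] := svalP q; rewrite (sublinear0 sq).
    + rewrite -ler_pdivrMl//; apply: (geE) => q Aq; rewrite ler_pdivrMl//.
      have [[_ qZ] _] := svalP q.
      by rewrite (le_trans (leE _ _ Aq))// qZ// ltW.
  have mp x : m x <= p x.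
    by have [_ qp] := svalP q0; rewrite (le_trans (leE _ _ Aq0)).
  exists (exist _ m (conj sm mp)) => q Aq; apply/asboolP => x; exact: leE.
- have [sq qp] := svalP q; exists (sval q); split=> // q' sq' q'q.
  have Tq' : sublinear q' /\ forall x, q' x <= p x.
    by split=> // x; rewrite (le_trans (q'q x)).
  by have /asboolP := qmin (exist _ q' Tq') (introT (asboolP _) q'q).
Qed.

(** Shrinking p in the direction u before minimising gives f(-u) <= -p u, which becomes the lower
    bound at u once f is odd. *)
Lemma hahn_banach p u : sublinear p -> exists f : V -> R,
  [/\ linear (f : V -> R^o), forall x, f x <= p x & p u <= f u].
Proof.
move=> /(sublinear_shrink u)[p' [sp' p'p p'u]].
have [f [sf fp' fmin]] := minimal_sublinear sp'.
have [fD fZ] := sf.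
have fN a : f (- a) = - f a.
  apply/eqP; rewrite eq_le; apply/andP; split.
    have [f' [sf' f'f f'a]] := sublinear_shrink a sf.
    by rewrite (le_trans _ f'a)// fmin.
  by have := sublinear_ge (- a) sf; rewrite opprK.
exists f; split.
- have fDD x y : f (x + y) = f x + f y.
    apply/eqP; rewrite eq_le fD/= -lerBrDr -fN.
    by rewrite -{1}(addrK y x) fD.
  move=> a x y; rewrite fDD; congr (_ + _).
  have [a0|a0] := leP 0 a; first by rewrite fZ.
  rewrite -[LHS]opprK -fN -scaleNr fZ; last by rewrite oppr_ge0 ltW.
  by rewrite mulNr opprK.
- by move=> x; rewrite (le_trans (fp' x)).
- by rewrite -[f u]opprK -fN lerNr (le_trans (fp' _)).
Qed.

End Sublinear.

Section Separation.
Variables (R : realType) (V : normedModType R).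

Lemma hahn_banach_bop (p : V -> R) (M : R) u : sublinear p ->
  (forall x, p x <= M * `|x|) ->
  exists f : dual V, (forall x, (f x : R) <= p x) /\ p u <= (f u : R).
Proof.
move=> sp pM; have [h [hl hp hu]] := hahn_banach u sp.
have h0 : h 0 = 0 by have := hl (-1) 0 0; rewrite scaler0 addr0 scaleN1r addNr.
have hN x : - h x = h (- x).
  by have := hl (-1) x 0; rewrite !scaleN1r h0 !addr0.
have [f fh] : exists f : bop V R^o, forall x, f x = h x.
  apply: (@bop_exists R V R^o h M hl) => x; rewrite ler_norml.
  rewrite (le_trans (hp x))// andbT lerNl.
  by rewrite hN (le_trans (hp _))// -(normrN x).
by exists f; split=> [x|]; rewrite fh.
Qed.

Lemma dual_separates (v : V) : v <> 0 -> exists f : dual V, f v <> 0.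
Proof.
move=> v0; have [||f [_ fv]] := @hahn_banach_bop (fun x => `|x|) 1 v.
- by split=> [x y|t x t0]; [exact: ler_normD|rewrite normrZ ger0_norm].
- by move=> x; rewrite mul1r.
by exists f => f0; move: fv; rewrite f0 normr_le0 => /eqP.
Qed.

Definition is_convex (S : set V) := forall x y (t : R),
  0 <= t -> t <= 1 -> S x -> S y -> S (t *: x + (1 - t) *: y).

End Separation.

(** * The Bishop-Phelps theorem *)

Section ConvexSeparation.
Variables (R : realType) (V : normedModType R).

(** Hahn-Banach is applied to the Minkowski gauge [g] of [D], the set O - W translated by [u]. D
    contains the ball of radius r about 0, which bounds g, and misses u because O and W are
    disjoint, which gives g u >= 1. A functional below g is at most 1 on D and at least 1 at u, so
    its values on O do not exceed those on W. *)
Lemma convex_separation (O W : set V) (o w0 : V) (r : R) :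
  is_convex O -> is_convex W -> 0 < r -> (forall z, `|z - o| < r -> O z) ->
  W w0 -> (forall z, O z -> ~ W z) ->
  exists2 x : dual V, x <> 0 & forall a b, O a -> W b -> (x b : R) <= x a.
Proof.
move=> cO cW r0 Or Ww0 OW.
pose u := w0 - o.
pose D : set V := [set v | exists a b, [/\ O a, W b & v = a - b + u]].
have D0 : D 0.
  exists o, w0; split=> //; first by apply: Or; rewrite subrr normr0.
  by rewrite /u addrA subrK subrr.
have Dconv v w (t : R) : 0 <= t -> t <= 1 -> D v -> D w ->
    D (t *: v + (1 - t) *: w).
  move=> t0 t1 [a [b [Oa Wb ->]]] [c [d [Oc Wd ->]]].
  exists (t *: a + (1 - t) *: c), (t *: b + (1 - t) *: d); split.
  - exact: cO.
  - exact: cW.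
  - have tu : u = t *: u + (1 - t) *: u by rewrite -scalerDl addrC subrK scale1r.
    by rewrite [X in _ = _ + X]tu opprD [X in _ = X + _]addrACA [RHS]addrACA !scalerDr !scalerN.
have Dball v : `|v| < r -> D v.
  move=> vr; exists (o + v), w0; split=> //; first by apply: Or; rewrite addrC addKr.
  by rewrite /u addrA subrK addrC addKr.
pose E v : set R := [set t | 0 < t /\ D (t^-1 *: v)].
pose g v := inf (E v).
have lbE v : has_lbound (E v) by exists 0 => t [/ltW].
have leE v t : 0 < t -> D (t^-1 *: v) -> g v <= t.
  by move=> t0 Dt; apply: ge_inf.
have EE v t : 0 < t -> `|v| < r * t -> E v t.
  move=> t0 vt; split=> //; apply: Dball.
  by rewrite normrZ gtr0_norm ?invr_gt0// mulrC ltr_pdivrMr.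
have geE v c : (forall t, 0 < t -> D (t^-1 *: v) -> c <= t) -> c <= g v.
  move=> h; apply: lb_le_inf; last by move=> t [t0 Dt]; exact: h.
  exists ((1 + `|v|) / r); apply: EE; first by rewrite divr_gt0// ltr_wpDr.
  by rewrite mulrC divfK ?gt_eqF// ltrDr.
have sg : sublinear g.
  apply: sublinear_hom => [v w||c v c0].
  - rewrite -lerBlDr; apply: (geE) => t t0 Dt; rewrite lerBlDr -lerBlDl.
    apply: (geE) => s s0 Ds; rewrite lerBlDl; apply: leE; first by rewrite addr_gt0.
    have ts0 : 0 < t + s by rewrite addr_gt0.
    rewrite (_ : _ *: _ = (t / (t + s)) *: (t^-1 *: v) +
        (1 - t / (t + s)) *: (s^-1 *: w)).
      apply: Dconv => //; first by rewrite divr_ge0// ltW.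
      by rewrite ler_pdivrMr// mul1r lerDl ltW.
    rewrite scalerDr !scalerA; congr (_ *: _ + _ *: _); field;
      by rewrite !gt_eqF.
  - apply/eqP; rewrite eq_le; apply/andP; split.
      by apply/ler_addgt0Pr => e e0; rewrite add0r leE// scaler0.
    by apply: (geE) => t /ltW.
  - rewrite -ler_pdivrMl//; apply: (geE) => t t0 Dt; rewrite ler_pdivrMl//.
    apply: leE; first by rewrite mulr_gt0.
    by rewrite invfM scalerA mulrAC mulVf ?mul1r// gt_eqF.
have gM v : g v <= r^-1 * `|v|.
  apply/ler_addgt0Pr => e e0.
  have [||e1 e2] := @EE v (r^-1 * `|v| + e); last exact: leE.
    by rewrite ltr_wpDl// mulr_ge0// invr_ge0 ltW.
  by rewrite mulrDr mulVKf ?gt_eqF// ltrDl mulr_gt0.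
have gu : 1 <= g u.
  apply: (geE) => t t0 Dt; rewrite leNgt; apply/negP => t1.
  have [a [b [Oa Wb]]] : D u.
    rewrite (_ : u = t *: (t^-1 *: u) + (1 - t) *: 0).
      by apply: Dconv => //; exact: ltW.
    by rewrite scaler0 addr0 scalerA divff ?scale1r// gt_eqF.
  rewrite -{1}(add0r u) => /addIr/esym/subr0_eq ab; apply: (OW a) => //.
  by rewrite ab.
have [f [fg fu]] := hahn_banach_bop u sg gM.
have fu1 := le_trans gu fu.
exists (- f) => [/eqP|a b Oa Wb].
  by rewrite oppr_eq0 => /eqP f0; move: fu1; rewrite f0 ler10.
have : (f (a - b + u) : R) <= 1.
  rewrite (le_trans (fg _))// leE// invr1 scale1r.
  by exists a, b.
rewrite !bopNE linearD linearB/= => h.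
suff : (f a : R) - f b <= 0 by rewrite subr_le0 lerN2.
by move: h fu1; set A := (f a : R); set B := (f b : R); set C := (f u : R); lra.
Qed.

End ConvexSeparation.

Section BishopPhelps.
Variables (R : realType) (V : normedModType R).

(** A predicate rather than a structure, because it is to be applied to [dual X], which is only
    declared as a normed space. *)
Definition cauchy_complete : Prop := forall u : nat -> V,
  (forall e : R, 0 < e -> exists N, forall m n, (N <= m)%N -> (N <= n)%N ->
     `|u m - u n| <= e) ->
  exists l : V, forall e : R, 0 < e -> exists N, forall n, (N <= n)%N ->
    `|u n - l| <= e.

Definition norm_closed (W : set V) : Prop :=
  forall z, (forall e : R, 0 < e -> exists2 w, W w & `|z - w| <= e) -> W z.

(** Ekeland's variational principle for the distance to p, with slope 1/2. Each term of [u] almost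
    minimises this distance over [S] of the previous term; the decrease of the distance controls the
    steps, so u is Cauchy, and its limit is the required point. A slope below 1 puts p in the set
    [O] of [bishop_phelps]. *)
Lemma ekeland (W : set V) (p z0 : V) : cauchy_complete -> norm_closed W ->
  W z0 -> exists w, [/\ W w, `|w - p| <= `|z0 - p| &
    forall z, W z -> `|z - p| + `|z - w| / 2 <= `|w - p| -> z = w].
Proof.
move=> cV cW Wz0.
pose S (w : V) : set V := [set z | W z /\ `|z - p| + `|z - w| / 2 <= `|w - p|].
have Sxx w : W w -> S w w by split=> //; rewrite subrr normr0 mul0r addr0.
have Strans u v w : S u v -> S v w -> S u w.
  move=> [Wv uv] [Ww vw]; split=> //.
  by have := ler_distD v w u; lra.
have next (nw : nat * V) : exists z, W nw.2 -> S nw.2 z /\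
    forall z', S nw.2 z' -> `|z - p| <= `|z' - p| + nw.1.+1%:R^-1.
  have [Ww|] := pselect (W nw.2); last by exists 0.
  pose E : set R := [set `|z - p| | z in S nw.2].
  have hE : has_inf E.
    split; first by exists `|nw.2 - p|, nw.2 => //; exact: Sxx.
    by exists 0 => _ [z _ <-].
  have e0 : 0 < nw.1.+1%:R^-1 :> R by rewrite invr_gt0.
  have [_ [z Sz <-] zE] := inf_adherent e0 hE.
  exists z => _; split=> // z' Sz'; rewrite (le_trans (ltW zE))// lerD2r.
  by apply: ge_inf; [case: hE|exists z'].
have [nx nxP] := choice next.
pose u := fix u n := if n is m.+1 then nx (m, u m) else z0.
have Wu n : W (u n).
  by elim: n => [//|n ih]; have [[]] := nxP (n, u n) ih.
have uS n k : S (u n) (u (n + k)%N).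
  elim: k => [|k ih]; first by rewrite addn0; exact: Sxx.
  apply: Strans ih _; rewrite addnS.
  by have [] := nxP ((n + k)%N, u (n + k)%N) (Wu _).
have uC : forall e : R, 0 < e -> exists N, forall m n, (N <= m)%N -> (N <= n)%N ->
    `|u m - u n| <= e.
  move=> e e0; pose E : set R := range (fun n => `|u n - p|).
  have hE : has_inf E by split; [exists `|u 0 - p|, 0%N|exists 0 => _ [n _ <-]].
  have [|_ [N _ <-] NE] := @inf_adherent R E (e / 4) _ hE.
    by rewrite divr_gt0.
  exists N.
  have close n : (N <= n)%N -> `|u n - u N| <= e / 2.
    move=> Nn; have [_] := uS N (n - N)%N; rewrite subnKC// => h.
    have : inf E <= `|u n - p| by apply: ge_inf; [case: hE|exists n].
    by lra.
  move=> m n /close um /close un.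
  by have := ler_distD (u N) (u m) (u n); rewrite (distrC (u N) (u n)); lra.
have [l ul] := cV u uC.
have Sl n : S (u n) l.
  split.
    apply: cW => e e0; have [N uN] := ul e e0; exists (u N) => //.
    by rewrite distrC uN.
  apply/ler_addgt0Pr => e e0; have [|N uN] := ul (e / 2); first by rewrite divr_gt0.
  have := uN (n + N)%N (leq_addl _ _) => h.
  have [_ h'] := uS n N.
  have h1 := ler_distD (u (n + N)%N) l p; have h2 := ler_distD (u (n + N)%N) l (u n).
  by rewrite (distrC l (u (n + N)%N)) in h1 h2; lra.
exists l; split; first by have [] := Sl 0%N.
  have [_ /=] := Sl 0%N; apply: le_trans; rewrite lerDl divr_ge0//.
move=> z Wz zl.
have lz : `|l - p| <= `|z - p|.
  apply/ler_addgt0Pr => e e0.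
  have [n ne] : exists n, n.+1%:R^-1 <= e.
    exists (Num.truncn e^-1); rewrite -[leRHS]invrK lef_pV2 ?posrE ?invr_gt0//.
    by rewrite ltW// truncnS_gt.
  have [_ h] := nxP (n, u n) (Wu n).
  have uz : `|u n.+1 - p| <= `|z - p| + n.+1%:R^-1.
    by apply: h; exact: Strans (Sl n) _.
  have [_ h'] := Sl n.+1; have := normr_ge0 (l - u n.+1).
  by move: ne uz; set i := n.+1%:R^-1; lra.
have : `|z - l| <= 0 by lra.
by rewrite normr_le0 subr_eq0 => /eqP.
Qed.

(** The set [O] is convex, disjoint from W by the choice of w, contains the ball of radius d / 3
    about p, and has w in its closure, as the points w + t (p - w) show. A functional separating O
    from W is therefore maximal over W at w. *)
Lemma bishop_phelps (W : set V) (p z0 : V) : cauchy_complete ->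
  norm_closed W -> is_convex W -> W z0 -> ~ W p ->
  exists w (x : dual V), [/\ W w, `|w - p| <= `|z0 - p|, x <> 0 &
    forall z, W z -> (x z : R) <= x w].
Proof.
move=> cV nW cW Wz0 Wp; have [w [Ww wz0 wmin]] := ekeland p cV nW Wz0.
pose d := `|w - p|.
have d0 : 0 < d.
  by rewrite normr_gt0 subr_eq0; apply: contra_notN Wp => /eqP <-.
pose O : set V := [set z | `|z - p| + `|z - w| / 2 < d].
have [||z zp|z Oz Wz|x x0 xle] := @convex_separation R V O W p w (d / 3) _ cW _ _ Ww.
- move=> z1 z2 t t0 t1; rewrite /O /= => O1 O2.
  have tE q : t *: z1 + (1 - t) *: z2 - q = t *: (z1 - q) + (1 - t) *: (z2 - q).
    by rewrite !scalerBr addrACA -opprD -scalerDl (addrC t) subrK scale1r.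
  have tn q : `|t *: z1 + (1 - t) *: z2 - q| <= t * `|z1 - q| + (1 - t) * `|z2 - q|.
    rewrite tE (le_trans (ler_normD _ _))// !normrZ ger0_norm// ger0_norm//.
    by rewrite subr_ge0.
  have h1 := tn p; have h2 := tn w.
  have : t * (`|z1 - p| + `|z1 - w| / 2) + (1 - t) * (`|z2 - p| + `|z2 - w| / 2) < d.
    have [->|tn0] := eqVneq t 0; first by lra.
    have tp : 0 < t by rewrite lt_neqAle eq_sym tn0.
    have : t * (`|z1 - p| + `|z1 - w| / 2) < t * d by rewrite ltr_pM2l.
    have : (1 - t) * (`|z2 - p| + `|z2 - w| / 2) <= (1 - t) * d.
      by rewrite ler_wpM2l ?subr_ge0// ltW.
    by lra.
  by lra.
- by rewrite divr_gt0.
- rewrite /O /=; have := ler_distD p z w; rewrite (distrC p w) -/d; lra.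
- by have := Oz; rewrite (wmin z Wz (ltW Oz)) /O /= subrr normr0 mul0r addr0 ltxx.
exists w, x; split=> // z Wz.
apply/ler_addgt0Pr => e e0.
pose c := `|(x (p - w) : R)|.
pose t := Num.min 1 (e / (1 + c)).
have c0 : 0 < 1 + c by rewrite ltr_pwDl// /c normr_ge0.
have t0 : 0 < t by rewrite /t lt_min ltr01; apply: divr_gt0.
have t1 : t <= 1 by rewrite ge_min lexx.
have tc : t * (1 + c) <= e by rewrite -ler_pdivlMr// ge_min lexx orbT.
have Ot : O (w + t *: (p - w)).
  rewrite /O /= (_ : w + t *: (p - w) - w = t *: (p - w)); last first.
    by rewrite addrAC subrr add0r.
  rewrite (_ : w + t *: (p - w) - p = (1 - t) *: (w - p)); last first.
    by rewrite scalerBl scale1r -scalerN opprB addrAC.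
  rewrite !normrZ (gtr0_norm t0) (@ger0_norm _ (1 - t)) ?subr_ge0//.
  rewrite (distrC p w) -/d.
  have : 0 < t * d by rewrite mulr_gt0.
  by lra.
have := xle _ _ Ot Wz; rewrite linearD linearZ/= => h; apply: (le_trans h).
rewrite lerD2l (le_trans _ tc)// mulrDr mulr1 ler_wpDl ?(ltW t0)//.
by rewrite (le_trans (ler_norm _))// normrM gtr0_norm.
Qed.

End BishopPhelps.

Lemma dual_cauchy_complete (R : realType) (X : normedModType R) :
  cauchy_complete (dual X).
Proof.
move=> u uC; have [|l ul] := @bop_cauchy_lim R X R^o nat \oo _ u.
  move=> e /uC[N uN]; exists [set n | (N <= n)%N]; first by exists N.
  by move=> m n; exact: uN.
exists l => e /ul[N _ uN]; exists N => n Nn; exact: uN.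
Qed.

(** * Invariant subspaces and finite dimension *)

Section ClosedSubspaces.
Variables (R : realType) (V W : normedModType R).

Lemma closed_subspace_kernel (I : Type) (Phi : I -> bop V W) (P : I -> Prop) :
  closed_subspace [set v | forall i, P i -> Phi i v = 0].
Proof.
split=> [v clv i Pi| i _|a u v Lu Lv i Pi].
- have [//|n0] := pselect (Phi i v = 0).
  have n1 : 0 < `|Phi i v| by rewrite normr_gt0; apply/eqP.
  have b0 : 0 < 1 + `|Phi i| by rewrite ltr_pwDl.
  have nb : nbhs v (ball v (`|Phi i v| / (1 + `|Phi i|))).
    by apply: nbhsx_ballx; rewrite divr_gt0.
  have [w [Lw]] := clv _ nb; rewrite -ball_normE => wv.
  have {wv} : `|v - w| * (1 + `|Phi i|) < `|Phi i v| by rewrite -ltr_pdivlMr.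
  have h : `|Phi i v| <= `|Phi i| * `|v - w|.
    by rewrite -{1}[Phi i v]subr0 -(Lw i Pi) -linearB ler_bop.
  by rewrite ltNge (le_trans h)// mulrDr mulr1 mulrC lerDr.
- by rewrite linear0.
- by rewrite linearP/= Lu// Lv// scaler0 addr0.
Qed.

End ClosedSubspaces.

Section Dimension.
Variables (R : realType).

Lemma bop_sumE (X Y : normedModType R) n (F : 'I_n -> bop X Y) x :
  (\sum_i F i) x = \sum_i F i x.
Proof. by apply: (big_morph (fun f : bop X Y => f x)). Qed.

Lemma exists_row_kernel n m (M : 'M[R]_(n, m)) : (m < n)%N ->
  exists2 u : 'rV[R]_n, u != 0 & u *m M = 0.
Proof.
move=> mn; have : kermx M != 0.
  rewrite kermx_eq0 /row_free; apply/negP => /eqP rM.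
  by have := rank_leq_col M; rewrite rM leqNgt mn.
move=> /matrix0Pn[i [j kij]]; exists (row i (kermx M)).
  by apply/matrix0Pn; exists 0, j; rewrite mxE.
by rewrite -row_mul mulmx_ker row0.
Qed.

Lemma dim_ge_kernel (V : normedModType R) n m (phi : 'I_m -> dual V) :
  (m < n)%N -> dim_ge V n -> exists2 v : V, v <> 0 & forall i, phi i v = 0.
Proof.
move=> mn [v vfree].
have [u u0 uM] := exists_row_kernel (\matrix_(j < n, i < m) phi i (v j)) mn.
exists (\sum_j u 0 j *: v j).
  move=> /vfree uj; move/eqP: u0; apply; apply/rowP => j.
  by rewrite uj mxE.
move=> i; rewrite linear_sum/=; move/rowP/(_ i) : uM; rewrite !mxE => uM.
by rewrite -[RHS]uM; apply: eq_bigr => j _; rewrite mxE linearZ.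
Qed.

(** Functionals are added one at a time: the first k have a common zero v other than 0, and a
    functional that does not vanish at v is independent of them. *)
Lemma dim_ge_dual (X : normedModType R) n : dim_ge X n -> dim_ge (dual X) n.
Proof.
move=> dX; suff h k : (k <= n)%N -> dim_ge (dual X) k by exact: h.
elim: k => [|k ih] kn; first by exists (fun _ => 0) => a _ [].
have [f ffree] := ih (ltnW kn).
have [v v0 fv] := dim_ge_kernel f kn dX.
have [g gv] := dual_separates v0.
exists (fun i => if unlift ord_max i is Some j then f j else g) => a.
rewrite big_ord_recr/= unlift_none.
rewrite (eq_bigr (fun i => a (lift ord_max i) *: f i)); last first.
  move=> i _; have -> : widen_ord (leqnSn k) i = lift ord_max i.
    by apply/val_inj; rewrite /= /bump leqNgt ltn_ord.
  by rewrite liftK.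
move=> s0.
have am : a ord_max = 0.
  have := congr1 (fun h : dual X => h v) s0.
  rewrite bopDE bop_sumE big1 ?add0r => [|i _]; last by rewrite bopZE fv scaler0.
  by rewrite bopZE bop0E => /eqP; rewrite scaler_eq0 => /orP[/eqP//|/eqP].
move: s0; rewrite am scale0r addr0 => /ffree al i.
by case: (unliftP ord_max i) => [j ->|->].
Qed.

End Dimension.

Section InvariantSubspaces.
Variables (R : realType) (X : normedModType R).
Implicit Types (A : set (bop X X)) (S T : bop X X).

Definition dual_invariant_subspace A : Prop :=
  exists L : set (dual X),
    [/\ closed_subspace L, L <> [set 0], L <> setT &
        forall T, A T -> adjoint T @` L `<=` L].

Lemma comp_bopE (Y Z W : normedModType R) (S : bop Y Z) (T : bop W Y) x :
  comp_bop S T x = S (T x).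
Proof. by []. Qed.

Lemma eval_bop (u : X) : exists Phi : bop (dual X) R^o, forall f, Phi f = f u.
Proof. by apply: (@bop_exists R (dual X) R^o _ `|u|) => // f; rewrite mulrC ler_bop. Qed.

(* A noninjective element of the commutant: its kernel has an invariant
   annihilator. *)
Lemma dual_invariant_of_noninjective A (P : bop X X) (u : X) :
  (forall S, A S -> S * P = P * S) -> P <> 0 -> u <> 0 -> P u = 0 ->
  dual_invariant_subspace A.
Proof.
move=> AP P0 u0 Pu; have [Phi PhiE] := choice eval_bop.
exists [set f | forall v, P v = 0 -> Phi v f = 0]; split.
- exact: closed_subspace_kernel.
- move=> L0; apply: P0; apply: bopP => v; rewrite bop0E.
  have [//|Pv0] := pselect (P v = 0); have [f fPv] := dual_separates Pv0.
  have : [set f | forall v, P v = 0 -> Phi v f = 0] (adjoint P f).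
    by move=> w Pw /=; rewrite PhiE adjointE Pw linear0.
  by rewrite L0 => /(congr1 (fun h : dual X => h v)).
- move=> LT; have [f fu] := dual_separates u0; apply: fu.
  have : [set f | forall v, P v = 0 -> Phi v f = 0] f by rewrite LT.
  by move=> /(_ u Pu); rewrite PhiE.
- move=> S AS _ [f /= Lf <-] v Pv; rewrite PhiE adjointE -PhiE; apply: Lf.
  by rewrite -bopME -AP// bopME Pv linear0.
Qed.

(** Three cases. If some (S T)^* w is nonzero, it lies in the largest invariant subspace contained
    in the kernel of x. If all of these vanish but A^* is not 0, the common kernel of A^* works:
    were it 0, every S^* w and then w itself would be 0. If A^* = 0, the kernel of x works, and it
    is nonzero for reasons of dimension. *)
Lemma dual_invariant_of_annihilated A (x : dual (dual X)) (w : dual X) :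
  dim_ge X 3 -> commutative_algebra A -> x <> 0 -> w <> 0 ->
  (forall S T, A S -> A T -> x (adjoint (S * T) w) = 0) ->
  dual_invariant_subspace A.
Proof.
move=> dX [A0 AL AM AC] x0 w0 xw.
have [hST|hST] := pselect (exists S T, [/\ A S, A T & adjoint (S * T) w <> 0]).
  have [S [T [AS AT STw]]] := hST.
  exists [set f | forall b, A b \/ b = 1 -> comp_bop x (adjoint b) f = 0]; split.
  - exact: closed_subspace_kernel.
  - move=> L0; apply: STw.
    suff : [set f | forall b, A b \/ b = 1 -> comp_bop x (adjoint b) f = 0]
      (adjoint (S * T) w) by rewrite L0.
    move=> b [Ab|->]; rewrite comp_bopE; last by rewrite adjoint1 xw.
    by rewrite -adjointM xw//; apply: AM.
  - move=> LT; apply: x0; apply: bopP => f.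
    have : [set f | forall b, A b \/ b = 1 -> comp_bop x (adjoint b) f = 0] f.
      by rewrite LT.
    by move=> /(_ 1 (or_intror erefl)); rewrite comp_bopE adjoint1.
  - move=> U AU _ [f Lf <-] b [Ab|->]; rewrite comp_bopE -adjointM.
      by apply: Lf; left; exact: AM.
    by apply: Lf; left; rewrite mulr1.
have {}hST S T : A S -> A T -> adjoint T (adjoint S w) = 0.
  by move=> AS AT; apply: contrapT => STw; apply: hST; exists S, T; rewrite adjointM.
have [hT|hT] := pselect (exists T f, A T /\ adjoint T f <> 0); last first.
  have {}hT T f : A T -> adjoint T f = 0.
    by move=> AT; apply: contrapT => Tf; apply: hT; exists T, f.
  have [f f0 xf] : exists2 f : dual X, f <> 0 & x f = 0.
    have [//|f f0 xf] := @dim_ge_kernel R (dual X) 3 1 (fun _ => x) _ (dim_ge_dual dX).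
    by exists f => //; exact: xf ord0.
  exists [set f | forall i : unit, True -> x f = 0]; split.
  - exact: closed_subspace_kernel.
  - move=> L0; apply: f0.
    suff : [set f | forall i : unit, True -> x f = 0] f by rewrite L0.
    by [].
  - move=> LT; apply: x0; apply: bopP => g.
    have : [set f | forall i : unit, True -> x f = 0] g by rewrite LT.
    exact.
  - by move=> T AT _ [g _ <-] _ _; rewrite hT// linear0.
have [T [f [AT Tf]]] := hT.
exists [set f | forall S, A S -> adjoint S f = 0]; split.
- exact: closed_subspace_kernel.
- move=> L0.
  have L0E g : (forall S, A S -> adjoint S g = 0) -> g = 0.
    by move=> Lg; suff : [set f | forall S, A S -> adjoint S f = 0] g by rewrite L0.
  by apply: w0; apply: (L0E) => S AS; apply: (L0E) => U AU; exact: hST.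
- move=> LT; apply: Tf.
  have : [set f | forall S, A S -> adjoint S f = 0] f by rewrite LT.
  by apply.
- move=> S AS _ [g Lg <-] U AU; rewrite (Lg S AS); exact: (linear0 (adjoint U)).
Qed.

End InvariantSubspaces.

(** * Annihilating polynomials and their real quadratic factors *)

Section FiniteDimension.
Variables (R : realType) (X : normedModType R).
Implicit Types (A : set (bop X X)) (S T : bop X X) (p q : {poly R}).

Definition poly_orbit S (p : {poly R}) (v : X) : X :=
  \sum_(i < size p) p`_i *: (S ^+ i) v.

Lemma poly_orbitE S p v n : (size p <= n)%N ->
  poly_orbit S p v = \sum_(i < n) p`_i *: (S ^+ i) v.
Proof.
move=> pn; rewrite /poly_orbit (big_ord_widen_cond _ xpredT (fun i => p`_i *: (S ^+ i) v) pn).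
rewrite big_mkcond; apply: eq_bigr => i _; case: ltnP => // pi.
by rewrite nth_default// scale0r.
Qed.

Lemma poly_orbitD S p q v : poly_orbit S (p + q) v = poly_orbit S p v + poly_orbit S q v.
Proof.
pose n := maxn (size p) (size q).
rewrite !(@poly_orbitE _ _ _ n) ?leq_maxl ?leq_maxr ?size_polyD//.
by rewrite -big_split; apply: eq_bigr => i _; rewrite coefD scalerDl.
Qed.

Lemma poly_orbitZ S (a : R) p v : poly_orbit S (a *: p) v = a *: poly_orbit S p v.
Proof.
rewrite (@poly_orbitE _ _ _ (size p)) ?size_scale_leq// scaler_sumr.
by apply: eq_bigr => i _; rewrite coefZ scalerA.
Qed.

Lemma poly_orbitX S p v : poly_orbit S ('X * p) v = S (poly_orbit S p v).
Proof.
rewrite (@poly_orbitE _ _ _ (size p).+1); last first.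
  by rewrite (leq_trans (size_polyMleq _ _))// size_polyX.
rewrite big_ord_recl coefXM scale0r add0r linear_sum; apply: eq_bigr => i _.
by rewrite linearZ/= coefXM exprS bopME.
Qed.

Lemma exists_annihilating_poly m (g : 'I_m -> X) S v :
  (forall x, exists c : 'I_m -> R, x = \sum_i c i *: g i) ->
  exists2 p : {poly R}, p != 0 & poly_orbit S p v = 0.
Proof.
move=> gX; have [c cE] := choice gX.
have [u u0 uM] := exists_row_kernel
  (\matrix_(j < m.+1, i < m) c ((S ^+ j) v) i) (ltnSn m).
have pE : poly_orbit S (\poly_(j < m.+1) u 0 (inord j)) v = 0.
  rewrite (@poly_orbitE _ _ _ m.+1) ?size_poly//.
  rewrite (eq_bigr (fun j : 'I_m.+1 =>
      \sum_i u 0 j *: (c ((S ^+ j) v) i *: g i))); last first.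
    move=> j _; rewrite coef_poly ltn_ord inord_val.
    by rewrite {1}(cE ((S ^+ j) v)) scaler_sumr.
  rewrite exchange_big big1//= => i _.
  under eq_bigr do rewrite scalerA.
  rewrite -scaler_suml; move/rowP/(_ i): uM; rewrite !mxE => uM.
  apply/eqP; rewrite scaler_eq0; apply/orP; left; apply/eqP; rewrite -[RHS]uM.
  by apply: eq_bigr => j _; rewrite mxE.
exists (\poly_(j < m.+1) u 0 (inord j)) => //; apply: contraNneq u0 => p0.
apply/eqP/rowP => j; rewrite mxE.
by have := congr1 (fun q : {poly R} => q`_j) p0; rewrite coef_poly ltn_ord inord_val coef0.
Qed.

(** A complex root a + i b of p either is real or makes (X - a)^2 + b^2 divide p, since the
    remainder, of degree at most 1, vanishes at a nonreal point. The factors are expanded with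
    ['X * r] to match [poly_orbitX]. *)
Lemma real_quadratic_factor (p : {poly R}) : (1 < size p)%N ->
  exists (a b : R) (r : {poly R}), (size r < size p)%N /\
    (p = 'X * r - a *: r \/
     p = 'X * ('X * r) - (2 * a) *: ('X * r) + (a ^+ 2 + b ^+ 2) *: r).
Proof.
move=> p1; pose toC := real_complex R.
have p0 : p != 0 by rewrite -size_poly_gt0 ltnW.
have small (q r : {poly R}) : (1 < size q)%N -> p = q * r -> (size r < size p)%N.
  move=> q1 pqr; have r0 : r != 0.
    by apply: contraNneq p0 => r0; rewrite pqr r0 mulr0.
  have q0 : q != 0 by rewrite -size_poly_gt0 ltnW.
  rewrite pqr size_mul//; case: (size q) q1 => [|[|k]]// _.
  by rewrite addSn /= addSn ltnS leq_addl.
have [z rz] : exists z, root (map_poly toC p) z.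
  by apply/closed_rootP; rewrite size_map_poly; move: p1; case: (size p) => [//|[]].
case: z rz => a b rz; have [b0|b0] := eqVneq b 0.
  move: rz; rewrite b0 (_ : (a +i* 0)%C = toC a)// fmorph_root => /factor_theorem[r pr].
  exists a, b, r; split.
    by apply: (small ('X - a%:P)); rewrite ?size_XsubC// mulrC.
  by left; rewrite pr mulrBr mulrC -mul_polyC [a%:P * r]mulrC.
pose q : {poly R} := 'X * 'X - (2 * a) *: 'X + (a ^+ 2 + b ^+ 2)%:P.
have sq : size q = 3%N.
  rewrite /q -addrA size_polyDl -expr2 size_polyXn//.
  rewrite (leq_ltn_trans (size_polyD _ _))// gtn_max.
  rewrite size_polyN (leq_ltn_trans (size_scale_leq _ _)) ?size_polyX//=.
  by rewrite (leq_ltn_trans (size_polyC_leq1 _)).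
have qz : (map_poly toC q).[(a +i* b)%C] = 0.
  rewrite /q rmorphD rmorphB rmorphM/= map_polyX map_polyZ map_polyX map_polyC.
  rewrite !hornerE/=; apply/eqP; rewrite eq_complex /=; simpc => /=.
  by apply/andP; split; apply/eqP; ring.
have pq : modp p q = 0.
  have sm : (size (modp p q) <= 2)%N.
    by rewrite -ltnS -sq ltn_modp -size_poly_gt0 sq.
  have mz : (map_poly toC (modp p q)).[(a +i* b)%C] = 0.
    have := rootP rz; rewrite {1}(divp_eq p q) rmorphD rmorphM/= hornerD hornerM.
    by rewrite qz mulr0 add0r.
  move: mz; set m := modp p q in sm *.
  have mE : m = (m`_1) *: 'X + (m`_0)%:P.
    apply/polyP => i; rewrite coefD coefZ coefX coefC.
    case: i => [|[|i]] /=; rewrite ?mulr0 ?mulr1 ?add0r ?addr0//.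
    by rewrite nth_default// (leq_trans sm).
  rewrite mE rmorphD/= map_polyZ map_polyX map_polyC !hornerE/=.
  move/eqP; rewrite eq_complex /=; simpc => /= /andP[/eqP m0 /eqP m1].
  move/eqP: m1; rewrite mulf_eq0 (negbTE b0) orbF => /eqP m1.
  by move: m0; rewrite m1 mul0r add0r => ->; rewrite scale0r addr0.
have pE : p = q * (divp p q) by rewrite mulrC {1}(divp_eq p q) pq addr0.
exists a, b, (divp p q); split; first by apply: (small q) => //; rewrite sq.
right; rewrite {1}pE /q mulrDl mulrBl -mulrA -!scalerAl; congr (_ + _).
by rewrite mul_polyC.
Qed.

End FiniteDimension.

Section QuadraticKernel.
Variables (R : realType) (X : normedModType R).
Implicit Types (A : set (bop X X)) (S T : bop X X) (p q : {poly R}).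

Lemma poly_orbitB S p q (v : X) :
  poly_orbit S (p - q) v = poly_orbit S p v - poly_orbit S q v.
Proof. by rewrite poly_orbitD -(scaleN1r q) poly_orbitZ scaleN1r. Qed.

(** Take p of least degree with p(S) v = 0, split off a factor and let r be the cofactor: u = r(S) v
    is nonzero by minimality, and the factor kills it. A linear factor is covered by b = 0. *)
Lemma exists_quadratic_kernel m (g : 'I_m -> X) S (v : X) :
  (forall x, exists c : 'I_m -> R, x = \sum_i c i *: g i) -> v <> 0 ->
  exists (a b : R) (u : X), u <> 0 /\
    ((S - a *: (1 : bop X X)) * (S - a *: (1 : bop X X)) +
      b ^+ 2 *: (1 : bop X X)) u = 0.
Proof.
move=> gX v0.
pose P n := `[< exists p, [/\ p != 0, size p = n & poly_orbit S p v = 0] >].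
have Pex : exists n, P n.
  have [p p0 pv] := exists_annihilating_poly S v gX.
  by exists (size p); apply/asboolP; exists p.
have := ex_minnP Pex => -[n /asboolP[p [p0 pn pv]] nmin].
have rmin (r : {poly R}) : r != 0 -> (size r < size p)%N -> poly_orbit S r v <> 0.
  move=> r0 rp rv; have /nmin : P (size r) by apply/asboolP; exists r.
  by rewrite -pn leqNgt rp.
have p1 : (1 < size p)%N.
  rewrite ltnNge; apply/negP => /size1_polyC pE; apply: v0.
  have c0 : p`_0 != 0 by apply: contraNneq p0 => c0; rewrite pE c0.
  have := pv; rewrite pE /poly_orbit size_polyC c0 big_ord1 coefC expr0 bop1E.
  by move/eqP; rewrite scaler_eq0 (negbTE c0) => /eqP.
have [a [b [r [rp pr]]]] := real_quadratic_factor p1.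
have r0 : r != 0.
  by apply: contraNneq p0 => r0; case: pr => ->; rewrite r0 ?mulr0 ?scaler0 ?subrr ?addr0.
have Sa w : (S - a *: (1 : bop X X)) w = S w - a *: w by [].
case: pr => pE.
  exists a, 0, (poly_orbit S r v); split; first exact: rmin.
  have Sr : (S - a *: (1 : bop X X)) (poly_orbit S r v) = 0.
    by rewrite Sa -poly_orbitX -poly_orbitZ -poly_orbitB -pE.
  by rewrite bopDE bopME Sr linear0 expr0n scale0r bop0E addr0.
exists a, b, (poly_orbit S r v); split; first exact: rmin.
have := pv; rewrite pE poly_orbitD poly_orbitB !poly_orbitZ !poly_orbitX.
set u := poly_orbit S r v => h.
rewrite bopDE bopME !Sa bopZE bop1E -[RHS]h linearB linearZ/= scalerDl addrA.
congr (_ + _); rewrite scalerBr opprB scalerA -expr2.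
rewrite (_ : 2 * a = a + a); last by ring.
by rewrite scalerDl opprD [a ^+ 2 *: u - _]addrC !addrA.
Qed.

End QuadraticKernel.

Section NearIdentity.
Variables (R : realType) (X : normedModType R).
Implicit Types (A : set (bop X X)) (S T : bop X X).

(** The unit ball is within [th] < 1 of a finite net. Approximating the remainder again and again,
    each time rescaled to the unit ball, writes x as a geometric series in net points; collecting
    equal points leaves a finite combination. *)
Lemma compact_near_id_span (K : bop X X) (c : R) : compact_op K ->
  `|1 - K| <= c -> c < 1 -> exists m (g : 'I_m -> X),
    forall x, exists a : 'I_m -> R, x = \sum_i a i *: g i.
Proof.
move=> cK Kc c1.
(* The distance c from x to [K x] plus the net precision (1 - c) / 2. *)
pose th := (1 + c) / 2.
have c0 : 0 <= c by exact: le_trans Kc.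
have th0 : 0 < th by rewrite /th; lra.
have th1 : th < 1 by rewrite /th; lra.
have [|s sK] := @compact_op_net R X K ((1 - c) / 2) cK.
  by lra.
have net x : exists p, `|x| <= 1 -> p \in s /\ `|x - p| <= th.
  have [x1|] := pselect (`|x| <= 1); last by exists 0.
  have [p ps Kp] := sK x x1; exists p => _; split=> //.
  have h : `|x - K x| <= c.
    by rewrite (le_trans (ler_bop (1 - K) x))// (le_trans _ Kc)// ler_piMr.
  by have := ler_distD (K x) x p; rewrite /th; lra.
have [sel selP] := choice net.
pose g (i : 'I_(size s)) := s`_i.
exists (size s), g.
suff unit_ball x : `|x| <= 1 -> exists a : 'I_(size s) -> R, x = \sum_i a i *: g i.
  move=> x; have x0 : 0 < 1 + `|x| by rewrite ltr_wpDr.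
  have [|a xa] := unit_ball ((1 + `|x|)^-1 *: x).
    by rewrite normrZ gtr0_norm ?invr_gt0// ler_pdivrMl// mulr1 lerDr.
  exists (fun i => (1 + `|x|) * a i).
  under eq_bigr do rewrite -scalerA.
  by rewrite -scaler_sumr -xa scalerA divff ?scale1r// gt_eqF.
move=> x1.
pose r n := iter n (fun y => th^-1 *: (y - sel y)) x.
have r1 n : `|r n| <= 1.
  elim: n => [//|n ih]; have [_ h] := selP _ ih.
  by rewrite /r iterS normrZ gtr0_norm ?invr_gt0// ler_pdivrMl// mulr1.
pose a (i : 'I_(size s)) : R^nat := [sequence th ^+ k * (index (sel (r k)) s == i)%:R]_k.
have xE n : x = \sum_i (series (a i) n) *: g i + th ^+ n *: r n.
  elim: n => [|n ih].
    rewrite big1 ?add0r ?expr0 ?scale1r// => i _.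
    by rewrite /series/= big_geq// scale0r.
  rewrite {1}ih; have [ss _] := selP _ (r1 n).
  have idx : (index (sel (r n)) s < size s)%N by rewrite index_mem.
  have -> : \sum_i series (a i) n.+1 *: g i =
      \sum_i series (a i) n *: g i + th ^+ n *: sel (r n).
    rewrite (eq_bigr (fun i => series (a i) n *: g i + a i n *: g i)); last first.
      by move=> i _; rewrite /series/= big_nat_recr//= scalerDl.
    rewrite big_split/=; congr (_ + _).
    rewrite (bigD1 (Ordinal idx))//= big1 ?addr0 => [|i /negPf ii].
      by rewrite /a/= eqxx mulr1 /g nth_index.
    rewrite /a /= (_ : (_ == _ :> nat) = false) ?mulr0 ?scale0r//.
    by rewrite eq_sym; exact: ii.
  have rS : th *: r n.+1 = r n - sel (r n).
    by rewrite /r iterS scalerA divff ?gt_eqF// scale1r.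
  by rewrite -addrA; congr (_ + _); rewrite exprSr -scalerA rS -scalerDr addrC subrK.
have ac i : cvgn (series (a i)).
  apply: (@series_le_cvg _ _ (geometric 1 th)).
  - by move=> n; rewrite mulr_ge0// exprn_ge0// ltW.
  - by move=> n; rewrite mulr_ge0// exprn_ge0// ltW.
  - move=> n; rewrite /= mul1r ler_piMr// ?exprn_ge0 ?(ltW th0)//.
    by case: (_ == _).
  - by apply: is_cvg_geometric_series; rewrite gtr0_norm.
exists (fun i => limn (series (a i))).
have l1 : \sum_i series (a i) n *: g i @[n --> \oo] --> \sum_i limn (series (a i)) *: g i.
  apply: cvg_big => [|i _]; first exact: add_continuous.
  by apply: cvgZr_tmp; exact: ac.
have l2 : \sum_i series (a i) n *: g i @[n --> \oo] --> x.
  apply/cvgrPdist_le => e e0.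
  have /cvgrPdist_le/(_ e e0) : th ^+ n @[n --> \oo] --> 0.
    by apply: cvg_expr; rewrite gtr0_norm.
  apply: filterS => n; rewrite sub0r normrN => h.
  rewrite {1}(xE n) addrAC subrr add0r normrZ (le_trans _ h)// ler_piMr//.
exact: norm_cvg_unique l2 l1.
Qed.

End NearIdentity.

Section FiniteDimensionalCase.
Variables (R : realType) (X : normedModType R).
Implicit Types (A : set (bop X X)) (S T : bop X X).

Local Notation I := (1 : bop X X).

(** Assume that there is no invariant subspace. For each S in A some (S - a)^2 + b^2 is
    noninjective, hence equal to 0. If A does not consist of scalars, some J = T - a has J^2 = -b^2
    with b nonzero. For J' = S - s with J'^2 = -t^2, the product (b J' - t J)(b J' + t J) vanishes,
    so one factor does and J' is a multiple of J. Thus v and J v span an invariant subspace, and its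
    annihilator is nonzero because the dual has dimension at least 3. *)
Lemma finite_dim_dual_invariant A m (g : 'I_m -> X) :
  dim_ge X 3 -> commutative_algebra A ->
  (forall x, exists c : 'I_m -> R, x = \sum_i c i *: g i) ->
  dual_invariant_subspace A.
Proof.
move=> dX [A0 AL AM AC] gX; apply: contrapT => NI.
have [v v0 _] := @dim_ge_kernel R X 3 0 (fun _ => 0) isT dX.
have comI (a : R) S : A S -> forall T, A T -> T * (S - a *: I) = (S - a *: I) * T.
  move=> AS T AT.
  by rewrite mulrBr mulrBl AC// -bop_scaleAr -bop_scaleAl mulr1 mul1r.
have dom (P Q : bop X X) : (forall S, A S -> S * P = P * S) -> P * Q = 0 ->
    P <> 0 -> Q = 0.
  move=> AP PQ P0; apply: bopP => w; apply: contrapT => Qw; apply: NI.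
  by apply: (@dual_invariant_of_noninjective _ _ A P (Q w)) => //; rewrite -bopME PQ.
have quad S : A S -> exists a b : R, (S - a *: I) * (S - a *: I) = - (b ^+ 2) *: I.
  move=> AS; have [a [b [u [u0 uE]]]] := exists_quadratic_kernel S gX v0.
  exists a, b; apply/eqP; rewrite scaleNr -subr_eq0 opprK; apply/eqP.
  apply: contrapT => P0; apply: NI.
  apply: (dual_invariant_of_noninjective _ P0 u0 uE) => T AT.
  have PT := comI a S AS T AT; set P := S - a *: I in PT *.
  rewrite (mulrDr T (P * P)) (mulrDl (P * P)). congr (_ + _).
    by rewrite mulrA PT -mulrA PT mulrA.
  by rewrite -bop_scaleAr -bop_scaleAl mulr1 mul1r.
have noplane (w : X) : ~ forall S, A S -> exists a b c d,
    S v = a *: v + b *: w /\ S w = c *: v + d *: w.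
  move=> vw; apply: NI; have [Phi PhiE] := choice (@eval_bop R X).
  exists [set f | forall z, z = v \/ z = w -> Phi z f = 0]; split.
  - exact: closed_subspace_kernel.
  - have [//|f f0 fK] := @dim_ge_kernel R (dual X) 3 2
      (fun i => Phi (if i == 0 then v else w)) _ (dim_ge_dual dX).
    move=> L0; apply: f0.
    suff : [set f | forall z, z = v \/ z = w -> Phi z f = 0] f by rewrite L0.
    by move=> z [->|->]; [exact: fK 0|exact: fK 1].
  - move=> LT; have [f fv] := dual_separates v0; apply: fv.
    have : [set f | forall z, z = v \/ z = w -> Phi z f = 0] f by rewrite LT.
    by move=> /(_ v (or_introl erefl)); rewrite PhiE.
  - move=> S AS _ [f Lf <-] z; rewrite PhiE adjointE.
    have fv : f v = 0 by rewrite -PhiE; apply: Lf; left.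
    have fw : f w = 0 by rewrite -PhiE; apply: Lf; right.
    have [a [b [c [d [Sv Sw]]]]] := vw S AS.
    by move=> [->|->]; rewrite ?Sv ?Sw linearD !linearZ/= fv fw !scaler0 addr0.
have [scal|] := pselect (forall S, A S -> exists a : R, S = a *: I).
  apply: (noplane v) => S /scal[a ->]; exists a, 0, a, 0.
  by rewrite bopZE bop1E scale0r addr0.
move=> /existsNP[T] /not_implyP[AT /forallNP nscal].
have [a [b]] := quad T AT; set J := T - a *: I => JJ.
have J0 : J <> 0 by move=> /subr0_eq; exact: nscal.
have cJ : forall U, A U -> U * J = J * U by exact: comI.
have b0 : b != 0.
  apply/eqP => b0; apply: (J0); apply: (dom J J cJ _ J0).
  by rewrite JJ b0 expr0n oppr0 scale0r.
apply: (noplane (J v)) => S AS; have [s [t]] := quad S AS.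
set J' := S - s *: I => JJ'.
have cS : forall U, A U -> U * J' = J' * U by exact: comI.
have JJ'C : J * J' = J' * J.
  by rewrite /J (mulrBr J') (mulrBl J') cS// -bop_scaleAr -bop_scaleAl mulr1 mul1r.
have fac : (b *: J' - t *: J) * (b *: J' + t *: J) = 0.
  have scM (c d : R) (U U' : bop X X) : (c *: U) * (d *: U') = (c * d) *: (U * U').
    by rewrite -bop_scaleAl -bop_scaleAr scalerA.
  rewrite (mulrBl (b *: J' + t *: J)) (mulrDr (b *: J')) (mulrDr (t *: J)) !scM.
  rewrite JJ JJ' JJ'C !scalerA (mulrC t b) opprD addrA addrK -scalerBl.
  by rewrite (_ : _ - _ = 0) ?scale0r//; ring.
have [e J'E] : exists e : R, J' = e *: J.
  have [E0|E0] := pselect (b *: J' - t *: J = 0).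
    exists (t / b); apply: (can_inj (scalerK b0)).
    by rewrite scalerA mulrC divfK//; apply: subr0_eq.
  exists (- t / b); apply: (can_inj (scalerK b0)).
  rewrite scalerA mulrC divfK// scaleNr; apply/eqP; rewrite -addr_eq0; apply/eqP.
  apply: (dom _ _ _ fac E0) => U AU.
  by rewrite (mulrBr U) (mulrBl U) -!bop_scaleAr -!bop_scaleAl cS// cJ.
have SE : S = s *: I + e *: J by rewrite -J'E /J' addrC subrK.
exists s, e, (- (e * b ^+ 2)), s.
split; rewrite {1}SE bopDE !bopZE bop1E// -bopME JJ bopZE bop1E.
by rewrite scalerA mulrN addrC.
Qed.

End FiniteDimensionalCase.

(** * Powers of operators of small essential norm *)

Section RealSequences.
Variable R : realType.
Implicit Types a b : nat -> R.

(** Crude, but linear in e: for t = 3^k >= 1 and e <= 1, the terms e, t e and t e^2 of (1 + e)(1 + t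
    e) add up to at most 3 t e. *)
Lemma exprn1D_le (e : R) k : 0 <= e -> e <= 1 -> (1 + e) ^+ k <= 1 + 3 ^+ k * e.
Proof.
move=> e0 e1; elim: k => [|k ih]; first by rewrite !expr0 mul1r lerDl.
rewrite exprS (le_trans (ler_wpM2l _ ih)) ?addr_ge0// exprS.
have : 1 <= 3 ^+ k :> R by rewrite exprn_ege1// ler1n.
set t := 3 ^+ k => t1.
have h1 : 0 <= e * (t - 1) by rewrite mulr_ge0 ?subr_ge0.
have h2 : 0 <= t * (e * (1 - e)) by rewrite !mulr_ge0 ?subr_ge0//; lra.
lra.
Qed.

Lemma exprn_small (q e : R) : 0 <= q -> q < 1 -> 0 < e -> exists n, q ^+ n <= e.
Proof.
move=> q0 q1 e0; have : q ^+ n @[n --> \oo] --> 0 by apply: cvg_expr; rewrite ger0_norm.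
move=> /cvgrPdist_le/(_ e e0)[N _ h]; exists N.
by have := h N (leqnn N); rewrite sub0r normrN ger0_norm// exprn_ge0.
Qed.

Lemma exists_max_upto b N : exists2 n, (n <= N)%N & forall k, (k <= N)%N -> b k <= b n.
Proof.
elim: N => [|N [n nN bn]]; first by exists 0%N => // k; rewrite leqn0 => /eqP->.
have [h|h] := leP (b N.+1) (b n).
  exists n; first exact: leqW.
  by move=> k; rewrite leq_eqVlt => /predU1P[->//|]; exact: bn.
exists N.+1 => // k; rewrite leq_eqVlt => /predU1P[->//|kN].
by rewrite (le_trans (bn k kN))// ltW.
Qed.

(** For the norms of the powers of an operator, this says that the spectral radius is at most 1. *)
Definition subexponential a := forall e : R, 0 < e ->
  exists B : R, forall n, a n <= B * (1 + e) ^+ n.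

(* Peaks are the maximisers of a n / (1 + e) ^ n for small e. *)
Lemma exists_peak a (j : nat) : (forall n, 0 <= a n) -> subexponential a ->
  (forall B : R, exists n, B < a n) ->
  exists n, [/\ (j <= n)%N, j%:R <= a n, forall k, (k <= n)%N -> a k <= a n &
    forall m, a (n + m)%N <= a n * (1 + j.+1%:R^-1) ^+ m].
Proof.
move=> a0 aE aU.
have [p _ pmax] := exists_max_upto a j.
have [k0 ak0] := aU (2 * (a p + j%:R)).
have j0 : 0 <= j%:R :> R by [].
have ak : 0 < a k0 by have := a0 p; lra.
(* The bound 1 / (j + 1) gives the required growth rate after the peak; the bound 3^-k0 gives (1 +
   d)^k0 <= 2, so that the maximum of [b] exceeds a p + j and the peak lies beyond j. *)
pose d : R := Num.min j.+1%:R^-1 (3 ^+ k0)^-1.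
have d0 : 0 < d by rewrite /d lt_min !invr_gt0 exprn_gt0// ltr0n.
have d1 : d <= 1 by rewrite /d ge_min invf_le1 ?ltr0n// ler1n.
have dk : (1 + d) ^+ k0 <= 2.
  rewrite (le_trans (exprn1D_le _ (ltW d0) d1))//.
  have : 3 ^+ k0 * d <= 1.
    by rewrite -ler_pdivlMl ?exprn_gt0// mulr1 /d ge_min lexx orbT.
  by lra.
pose b n := a n / (1 + d) ^+ n.
have D0 n : 0 < (1 + d) ^+ n by rewrite exprn_gt0// ltr_wpDr// ltW.
have bk : a k0 / 2 <= b k0 by rewrite /b ler_pM2l// lef_pV2 ?posrE.
have [B aB] : exists B : R, forall n, a n <= B * (1 + d / 2) ^+ n.
  by apply: aE; rewrite divr_gt0.
have B0 : 0 <= B.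
  by have := aB 0%N; rewrite expr0 mulr1; apply: le_trans; exact: a0.
have [N bN] : exists N, forall n, (N <= n)%N -> b n <= b k0.
  pose q := (1 + d / 2) / (1 + d).
  have q0 : 0 <= q by rewrite divr_ge0//; lra.
  have q1 : q < 1 by rewrite /q ltr_pdivrMr; lra.
  have [|N qN] := @exprn_small q (b k0 / (B + 1)) q0 q1.
    by rewrite divr_gt0// ?ltr_wpDl// /b divr_gt0.
  exists N => n Nn; have bB : b n <= B * q ^+ n.
    rewrite /b /q expr_div_n ler_pdivrMr// mulrA divfK ?gt_eqF//; exact: aB.
  have qn : q ^+ n <= q ^+ N by rewrite ler_wiXn2l// ltW.
  rewrite ler_pdivlMr in qN; last by rewrite ltr_wpDl.
  have := exprn_ge0 N q0; have := exprn_ge0 n q0; nra.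
have [n nN nmax] := exists_max_upto b (N + k0).
have bmax k : b k <= b n.
  have [kN|/ltnW kN] := leqP k (N + k0); first exact: nmax.
  rewrite (le_trans (bN k _))//; first by rewrite (leq_trans (leq_addr k0 N)).
  by apply: nmax; rewrite leq_addl.
have aM k m : (k <= m)%N -> (1 + d) ^+ k <= (1 + d) ^+ m.
  by move=> km; rewrite ler_weXn2l// lerDl ltW.
have anb : b n <= a n.
  by rewrite /b ler_pdivrMr// ler_peMr// exprn_ege1// lerDl ltW.
have big : a p + j%:R < a n.
  by have := bmax k0; move: anb bk; lra.
have gr m : a (n + m)%N <= a n * (1 + d) ^+ m.
  have := bmax (n + m)%N; rewrite /b ler_pdivrMr// exprD mulrA.
  by rewrite divfK ?gt_eqF.
exists n; split.
- by rewrite leqNgt; apply/negP => /ltnW nj; have := pmax n nj; lra.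
- by have := a0 p; lra.
- move=> k kn; have := bmax k; rewrite /b ler_pdivrMr// => h.
  by rewrite (le_trans h)// mulrAC ler_pdivrMr// ler_wpM2l// aM.
- move=> m; rewrite (le_trans (gr m))// ler_wpM2l// lerXn2r// ?nnegrE.
  + by rewrite addr_ge0// ltW.
  + by rewrite addr_ge0.
  + by rewrite lerD2l /d ge_min lexx.
Qed.

(** By Bernoulli's inequality s = 1 - 1 / (2 m) satisfies s^m >= 1/2 >= b m, so the bound propagates
    in steps of m; for n <= m it holds because s^n >= 1/2, whence the factor 2 in the constant. *)
Lemma submultiplicative_decay b m : (forall n, 0 <= b n) ->
  (forall n k, b (n + k)%N <= b n * b k) -> (0 < m)%N -> b m <= 2^-1 ->
  exists s B : R, [/\ 0 < s, s < 1 & forall n, b n <= B * s ^+ n].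
Proof.
move=> b0 bM m0 bm.
have m0' : 0 < m%:R :> R by rewrite ltr0n.
pose x : R := (2 * m%:R)^-1; pose s : R := 1 - x.
have x0 : 0 < x by rewrite invr_gt0 mulr_gt0.
have xm : m%:R * x = 2^-1 by rewrite /x invfM mulrCA divff ?mulr1// gt_eqF.
have x1 : x <= 2^-1.
  by rewrite -xm ler_peMl ?ler1n// (ltW x0).
have s0 : 0 < s by rewrite /s; lra.
have s1 : s < 1 by rewrite /s; lra.
have bern k : 1 - k%:R * x <= s ^+ k.
  elim: k => [|k ih]; first by rewrite mul0r subr0 expr0.
  rewrite exprS; apply: (le_trans _ (ler_wpM2l (ltW s0) ih)).
  rewrite -natr1 /s; have : 0 <= k%:R :> R by [].
  by set t := k%:R; nra.
have sm : 2^-1 <= s ^+ m by have := bern m; rewrite xm; lra.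
have [p _ pmax] := exists_max_upto b m.
exists s, (2 * b p); split=> // n; elim/ltn_ind: n => n ih.
have [nm|mn] := leqP n m.
  have sn : s ^+ m <= s ^+ n by rewrite ler_wiXn2l ?ltW.
  by have := pmax n nm; have := b0 p; nra.
have nE : n = (m + (n - m))%N by rewrite subnKC// ltnW.
have h1 : b n <= b m * b (n - m)%N by rewrite {1}nE.
have h2 : b (n - m)%N <= 2 * b p * s ^+ (n - m) by apply: ih; rewrite ltn_subrL m0 (leq_trans m0)// ltnW.
rewrite {2}nE exprD.
rewrite (le_trans h1)// mulrCA ler_pM//; exact: le_trans bm sm.
Qed.

End RealSequences.

(** * Limits of powers along ultrafilters *)

Section PowerLimits.
Variables (R : realType) (X : completeNormedModType R).
Implicit Types S T P : bop X X.

Definition powers_to0 T := forall e : R, 0 < e ->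
  exists N, forall n, (N <= n)%N -> `|T ^+ n| <= e.

Lemma limit_commute (I : Type) (U : set_system I) (UU : ProperFilter U)
    (P : I -> bop X X) Q S : (forall i, S * P i = P i * S) ->
  (forall e : R, 0 < e -> U [set i | `|P i - Q| <= e]) -> S * Q = Q * S.
Proof.
move=> SP PQ; apply/eqP; rewrite -subr_eq0 -normr_le0; apply/ler_addgt0Pr => e e0.
have d0 : 0 < e / (2 * (1 + `|S|)) by rewrite divr_gt0// mulr_gt0// ltr_wpDr.
have [i /= PiQ] := filter_ex (PQ _ d0).
rewrite add0r (_ : S * Q - Q * S = (P i - Q) * S - S * (P i - Q)); last first.
  by rewrite mulrBl mulrBr SP opprB [RHS]addrC addrA subrK.
rewrite (le_trans (ler_normB _ _))//.
have h : `|P i - Q| * (1 + `|S|) <= e / 2.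
  rewrite (_ : e / 2 = e / (2 * (1 + `|S|)) * (1 + `|S|)).
    by rewrite ler_wpM2r// addr_ge0.
  by field; rewrite gt_eqF// ltr_wpDr.
have := bop_normM (P i - Q) S; have := bop_normM S (P i - Q).
by have := normr_ge0 (P i - Q); lra.
Qed.

(* T^N = T^i T^(N-i-i') T^i' with T^i and T^i' close to compact operators, so Vala's
   theorem applies. *)
Lemma powers_cluster (k : R) T (U : set_system nat) (UU : UltraFilter U)
    (N : nat -> nat) (c : nat -> R) (M : R) :
  ess_le k T -> k < 1 -> (forall n, U [set j | (n <= j)%N]) ->
  (forall j, (j <= N j)%N) ->
  (forall j m, (m <= j)%N -> `|c j *: T ^+ (N j - m)| <= M) ->
  exists Q : bop X X, forall e : R, 0 < e -> U [set j | `|c j *: T ^+ N j - Q| <= e].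
Proof.
move=> Tk k1 Ut jN cM; apply: bop_cauchy_lim => e e0.
have k0 : 0 <= k by case: Tk => K _; apply: le_trans.
have M0 : 0 <= M by apply: le_trans (cM 0%N 0%N (leqnn _)).
have [|i iM] := @exprn_small R k (e / (6 * (1 + M))) k0 k1.
  by rewrite divr_gt0// mulr_gt0// ltr_wpDr.
have [C cC TC] := ess_leX i Tk.
have CM0 : 0 < 6 * (1 + M * `|C|) by rewrite mulr_gt0// ltr_wpDr// mulr_ge0.
have [|i' i'M] := @exprn_small R k (e / (6 * (1 + M * `|C|))) k0 k1.
  by rewrite divr_gt0.
have [C' cC' TC'] := ess_leX i' Tk.
pose Q j := c j *: T ^+ (N j - (i + i')).
have UQ : U [set j | `|Q j| <= M].
  by apply: filterS (Ut (i + i')%N) => j /= ij; exact: cM.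
have [|J UJ JQ] := compact_op_sandwich_cauchy UU cC cC' UQ (e := e / 3).
  by rewrite divr_gt0.
exists (J `&` [set j | (i + i' <= j)%N]); first exact: filterI.
have near j : (i + i' <= j)%N -> `|c j *: T ^+ N j - C * Q j * C'| <= e / 3.
  move=> ij; have iN : (i + i' <= N j)%N := leq_trans ij (jN j).
  have QT : c j *: T ^+ (N j - i) = Q j * T ^+ i'.
    by rewrite /Q -bop_scaleAl -exprD subnDA subnK// leq_subRL ?(leq_trans (leq_addr i' i)).
  have PT : c j *: T ^+ N j = T ^+ i * (c j *: T ^+ (N j - i)).
    by rewrite -bop_scaleAr -exprD subnKC// (leq_trans (leq_addr i' i)).
  rewrite (_ : _ - _ = (T ^+ i - C) * (c j *: T ^+ (N j - i)) +
      C * Q j * (T ^+ i' - C')); last first.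
    rewrite mulrBl -PT QT mulrBr -(mulrA C (Q j) (T ^+ i')).
    by rewrite addrA subrK.
  rewrite (le_trans (ler_normD _ _))//.
  have h1 : `|(T ^+ i - C) * (c j *: T ^+ (N j - i))| <= e / 6.
    rewrite (le_trans (bop_normM _ _))//.
    have c1 : `|c j *: T ^+ (N j - i)| <= M.
      by apply: cM; rewrite (leq_trans _ ij)// leq_addr.
    have : k ^+ i * (6 * (1 + M)) <= e.
      by rewrite -ler_pdivlMr// mulr_gt0// ltr_wpDr.
    have : `|T ^+ i - C| * `|c j *: T ^+ (N j - i)| <= k ^+ i * M by rewrite ler_pM.
    by have := exprn_ge0 i k0; lra.
  have h2 : `|C * Q j * (T ^+ i' - C')| <= e / 6.
    rewrite (le_trans (bop_normM _ _))//.
    have c1 : `|C * Q j| <= `|C| * M.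
      by rewrite (le_trans (bop_normM _ _))// ler_wpM2l// cM.
    have : k ^+ i' * (6 * (1 + M * `|C|)) <= e by rewrite -ler_pdivlMr.
    have : `|C * Q j| * `|T ^+ i' - C'| <= (`|C| * M) * k ^+ i' by rewrite ler_pM.
    by have := exprn_ge0 i' k0; lra.
  by lra.
move=> j j' [Jj /near jn] [Jj' /near jn'].
have := JQ j j' Jj Jj'; move: jn jn'.
set P := c j *: _; set P' := c j' *: _; set Z := C * _ * _; set Z' := C * _ * _.
move=> h1 h2 h3; rewrite [leRHS](_ : e = e / 3 + (e / 3 + e / 3)); last by field.
apply: (le_trans (ler_distD Z P P')); apply: lerD; first exact: h1.
apply: (le_trans (ler_distD Z' Z P')); apply: lerD; first exact: h3.
by rewrite distrC; exact: h2.
Qed.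

(** A substitute for an eigenspace: P commutes with all that commutes with T, so for T in A + R 1 it
    meets the requirements of [dual_invariant_of_noninjective]. *)
Definition noninjective_bicommutant T : Prop := exists (P : bop X X) (u : X),
  [/\ forall S, S * T = T * S -> S * P = P * S, P <> 0, u <> 0 & P u = 0].

Definition identity_near_compact (Y : normedModType R) : Prop :=
  exists (K : bop Y Y) (c : R), [/\ compact_op K, `|1 - K| <= c & c < 1].

(* If W is a limit of powers T^n and V a limit of powers T^(n-m), with
   n - m going to infinity, then V W = W; and V = 1 makes 1 a compact operator. *)
Lemma bounded_powers_dichotomy (k M : R) T : ess_le k T -> k < 1 ->
  (forall n, `|T ^+ n| <= M) -> ~ powers_to0 T ->
  noninjective_bicommutant T \/ identity_near_compact X.
Proof.
move=> Tk k1 TM Tn0.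
have k0 : 0 <= k by case: Tk => K _; apply: le_trans.
have M0 : 0 <= M by apply: le_trans (TM 0%N).
have [U [UU ooU]] := ultraFilterLemma (_ : ProperFilter \oo).
have Ut n : U [set j | (n <= j)%N] by apply: ooU; exists n.
have powlim (N : nat -> nat) : (forall j, (j <= N j)%N) ->
    exists Q : bop X X, forall e : R, 0 < e -> U [set j | `|T ^+ N j - Q| <= e].
  move=> jN; have [//|Q QP] := @powers_cluster k T U UU N (fun=> 1) M Tk k1 Ut jN.
    by move=> j m _; rewrite scale1r.
  by exists Q => e /QP; apply: filterS => j /=; rewrite scale1r.
have [W WP] := powlim id (fun j => leqnn j).
(* As T^m = T^(m - n) T^n and |T^(m - n)| <= M, a single later power of norm above e bounds |T^n|
   from below. *)
have [c c0 Tc] : exists2 c : R, 0 < c & forall n, c <= `|T ^+ n|.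
  move/existsNP : Tn0 => [e /not_implyP[e0 /forallNP Ne]].
  exists (e / (M + 1)); first by rewrite divr_gt0// ltr_wpDl.
  move=> n; have /existsNP[m /not_implyP[nm /negP]] := Ne n.
  rewrite -ltNge => eT; rewrite ler_pdivrMr ?ltr_wpDl//.
  rewrite (le_trans (ltW eT))// -(subnK nm) exprD mulrC.
  rewrite (le_trans (bop_normM _ _))// ler_wpM2r// (le_trans (TM _))// lerDl//.
have W0 : W <> 0.
  move=> W0; have [|n /= WnP] := filter_ex (WP (c / 2) _).
    by rewrite divr_gt0.
  by move: WnP (Tc n); rewrite W0 subr0; lra.
have gap (j : nat) : exists mn : nat * nat, [/\ (j <= mn.2 - mn.1)%N, (mn.1 <= mn.2)%N,
    `|T ^+ mn.1 - W| <= j.+1%:R^-1 & `|T ^+ mn.2 - W| <= j.+1%:R^-1].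
  have e0 : 0 < j.+1%:R^-1 :> R by rewrite invr_gt0.
  have [m /= mP] := filter_ex (WP _ e0).
  have [n [nP /= mn]] := filter_ex (filterI (WP _ e0) (Ut (m + j)%N)).
  exists (m, n); split; [|exact: leq_trans (leq_addr _ _) mn|exact: mP|exact: nP].
  by rewrite /= leq_subRL// (leq_trans (leq_addr _ _) mn).
have [f fP] := choice gap.
pose N j := ((f j).2 - (f j).1)%N.
have jN j : (j <= N j)%N by have [] := fP j.
have [V VP] := powlim N jN.
have inv_small (e : R) : 0 < e -> U [set j | j.+1%:R^-1 <= e].
  move=> e0; apply: filterS (Ut (Num.truncn e^-1)) => j /= ej.
  rewrite -[leRHS]invrK lef_pV2 ?posrE ?invr_gt0//.
  by rewrite ltW// (lt_le_trans (truncnS_gt _))// ler_nat.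
have VW : V * W = W.
  apply/eqP; rewrite -subr_eq0 -normr_le0; apply/ler_addgt0Pr => e e0.
  pose d := e / (`|W| + M + 1).
  have D0 : 0 < `|W| + M + 1 by rewrite ltr_wpDl// addr_ge0.
  have d0 : 0 < d by rewrite divr_gt0.
  have [j [/= Vj dj]] := filter_ex (filterI (VP d d0) (inv_small d d0)).
  have [_ mn mP nP] := fP j.
  have TT : T ^+ (f j).2 = T ^+ N j * T ^+ (f j).1 by rewrite -exprD subnK.
  rewrite add0r (_ : V * W - W = (T ^+ (f j).2 - W) - T ^+ N j * (T ^+ (f j).1 - W)
      - (T ^+ N j - V) * W); last first.
    rewrite mulrBr mulrBl -TT !opprB [RHS]addrC [X in _ = _ + X]addrC.
    by rewrite [X in _ = _ + X]addrA subrK addrA subrK.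
  have := ler_normB ((T ^+ (f j).2 - W) - T ^+ N j * (T ^+ (f j).1 - W)) ((T ^+ N j - V) * W).
  have := ler_normB (T ^+ (f j).2 - W) (T ^+ N j * (T ^+ (f j).1 - W)).
  have h1 : `|(T ^+ N j - V) * W| <= d * `|W|.
    by rewrite (le_trans (bop_normM _ _))// ler_wpM2r.
  have h2 : `|T ^+ N j * (T ^+ (f j).1 - W)| <= M * d.
    by rewrite (le_trans (bop_normM _ _))// ler_pM// (le_trans mP).
  have h3 : `|T ^+ (f j).2 - W| <= d by rewrite (le_trans nP).
  have : d * (`|W| + M + 1) <= e by rewrite -ler_pdivlMr.
  by move: h1 h2 h3 d0; clear; lra.
have [V1|V1] := pselect (V = 1); last first.
  left; have [x Wx] : exists x, W x <> 0.
    by apply/existsNP => W00; apply: W0; apply: bopP.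
  exists (V - 1), (W x); split=> //.
  - move=> S ST; rewrite mulrBr mulrBl mulr1 mul1r; congr (_ - _).
    by apply: (@limit_commute _ U _ (fun j => T ^+ N j) V S) => // j; exact: commrX.
  - by move=> /subr0_eq.
  - by rewrite -bopME mulrBl VW mul1r subrr.
(* With V = 1, a power of T lies within 1/4 of 1 and within 1/4 of a compact operator. *)
right; have q0 : 0 < 4^-1 :> R by lra.
have [n kn] := exprn_small k0 k1 q0.
have [j [/= Vj nj]] := filter_ex (filterI (VP _ q0) (Ut n)).
have [K cK TK] := ess_leX (N j) Tk.
exists K, (2^-1); split=> //; last by lra.
have kN : k ^+ N j <= 4^-1.
  by rewrite (le_trans _ kn)// ler_wiXn2l// ?ltW// (leq_trans nj).
rewrite -V1 [leRHS](_ : 2^-1 = 4^-1 + 4^-1); last by field.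
apply: (le_trans (ler_distD (T ^+ N j) V K)); apply: lerD; last exact: le_trans kN.
by rewrite distrC; exact: Vj.
Qed.

(* For unbounded powers, a limit Q of T^N / |T^N| along peaks N satisfies Q^2 = 0. *)
Lemma subexponential_powers_dichotomy (k : R) T : ess_le k T -> k < 1 ->
  subexponential (fun n => `|T ^+ n|) -> ~ powers_to0 T ->
  noninjective_bicommutant T \/ identity_near_compact X.
Proof.
move=> Tk k1 Tsub Tn0.
have [[M TM]|Tunb] := pselect (exists M : R, forall n, `|T ^+ n| <= M).
  exact: bounded_powers_dichotomy Tk k1 TM Tn0.
have {}Tunb (B : R) : exists n, B < `|T ^+ n|.
  apply: contrapT => /forallNP h; apply: Tunb; exists B => n.
  by have /negP := h n; rewrite -leNgt.
left; have [N NP] := choice (fun j => @exists_peak R (fun n => `|T ^+ n|) j.+1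
  (fun n => normr_ge0 _) Tsub Tunb).
have N0 j : 0 < `|T ^+ N j|.
  by have [_ h _ _] := NP j; rewrite (lt_le_trans _ h)// ltr0n.
pose c j := `|T ^+ N j|^-1.
have c0 j : 0 < c j by rewrite invr_gt0.
have [U [UU ooU]] := ultraFilterLemma (_ : ProperFilter \oo).
have Ut n : U [set j | (n <= j)%N] by apply: ooU; exists n.
have [||Q QP] := @powers_cluster k T U UU N c 1 Tk k1 Ut.
- by move=> j; have [/ltnW] := NP j.
- move=> j m mj; have [_ _ h _] := NP j.
  by rewrite normrZ gtr0_norm// ler_pdivrMl// mulr1 h// leq_subr.
have P1 j : `|c j *: T ^+ N j| = 1.
  by rewrite normrZ gtr0_norm// mulVf// gt_eqF.
have Q0 : Q <> 0.
  have h0 : 0 < 2^-1 :> R by lra.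
  move=> Q0; have [j /=] := filter_ex (QP _ h0).
  by rewrite Q0 subr0 P1; lra.
(* The peak property bounds |T^(N j + m)| / |T^(N j)| by (1 + 1 / (j + 2))^m, which is at most 2
   once j >= 3^m; the remaining 1 is for the approximation of Q. *)
have TQ m : `|T ^+ m * Q| <= 3.
  have d0 : 0 < (1 + `|T ^+ m|)^-1 by rewrite invr_gt0 ltr_wpDr.
  have [j [/= jQ mj]] := filter_ex (filterI (QP _ d0) (Ut (3 ^ m)%N)).
  have h1 : `|T ^+ m * (c j *: T ^+ N j)| <= 2.
    have [_ _ _ h] := NP j.
    rewrite -bop_scaleAr -exprD addnC normrZ gtr0_norm// ler_pdivrMl//.
    rewrite (le_trans (h m))// ler_wpM2l//.
    have e1 : j.+2%:R^-1 <= 1 :> R by rewrite invf_le1 ?ler1n.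
    rewrite (le_trans (exprn1D_le _ _ e1))//.
    have : 3 ^+ m * j.+2%:R^-1 <= 1 :> R.
      by rewrite ler_pdivrMr// mul1r -natrX ler_nat (leq_trans mj)// ltnW.
    by set z := 3 ^+ m * _; lra.
  have h2 : `|T ^+ m * (c j *: T ^+ N j - Q)| <= 1.
    rewrite (le_trans (bop_normM _ _))//.
    rewrite (le_trans (ler_wpM2l (normr_ge0 _) jQ))//.
    by rewrite ler_pdivrMr ?ltr_wpDr// mul1r lerDr.
  rewrite (_ : T ^+ m * Q = T ^+ m * (c j *: T ^+ N j) - T ^+ m * (c j *: T ^+ N j - Q)).
    by rewrite (le_trans (ler_normB _ _))//; lra.
  by rewrite mulrBr opprB addrC subrK.
(* Up to a small error, Q Q is T^(N j) Q / |T^(N j)|, of norm at most 3 / |T^(N j)|. *)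
have QQ : Q * Q = 0.
  apply/eqP; rewrite -normr_le0; apply/ler_addgt0Pr => e e0; rewrite add0r.
  have Q1 : 0 < 1 + `|Q| by rewrite ltr_wpDr.
  have d0 : 0 < e / 2 / (1 + `|Q|) by rewrite !divr_gt0.
  have [j [/= jQ mj]] := filter_ex (filterI (QP _ d0) (Ut (Num.truncn (6 / e)))).
  have h1 : `|(c j *: T ^+ N j) * Q| <= e / 2.
    rewrite -bop_scaleAl normrZ gtr0_norm// ler_pdivrMl//.
    rewrite (le_trans (TQ _))//; have [_ h _ _] := NP j.
    have : 6 / e <= `|T ^+ N j|.
      by rewrite (le_trans _ h)// (le_trans (ltW (truncnS_gt _)))// ler_nat ltnS.
    by rewrite ler_pdivrMr//; lra.
  have h2 : `|(c j *: T ^+ N j - Q) * Q| <= e / 2.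
    rewrite (le_trans (bop_normM _ _))//.
    rewrite (le_trans (ler_wpM2r (normr_ge0 _) jQ))//.
    rewrite mulrAC ler_pdivrMr// ler_wpM2l ?lerDr//.
    by rewrite divr_ge0// ltW.
  rewrite (_ : Q * Q = (c j *: T ^+ N j) * Q - (c j *: T ^+ N j - Q) * Q).
    by rewrite (le_trans (ler_normB _ _))//; lra.
  by rewrite mulrBl opprB addrC subrK.
have [v Qv] : exists v, Q v <> 0.
  by apply/existsNP => Q00; apply: Q0; apply: bopP.
exists Q, (Q v); split=> //; last by rewrite -bopME QQ.
move=> S ST; apply: (@limit_commute _ U _ (fun j => c j *: T ^+ N j) Q S) => // j.
by rewrite -bop_scaleAr -bop_scaleAl; congr (_ *: _); exact: commrX.
Qed.

(* Rescaling T to spectral radius 1 makes its powers subexponential. *)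
Lemma powers_dichotomy (k : R) T : ess_le k T -> k < 1 -> ~ powers_to0 T ->
  noninjective_bicommutant T \/ identity_near_compact X.
Proof.
move=> Tk k1 Tn0.
have geo0 (s B : R) (S : bop X X) : 0 <= s -> s < 1 ->
    (forall n, `|S ^+ n| <= B * s ^+ n) -> powers_to0 S.
  move=> s0 s1 SB e e0.
  have B0 : 0 <= B by have := SB 0%N; rewrite !expr0 mulr1; apply: le_trans.
  have B1 : 0 < B + 1 by rewrite ltr_wpDl.
  have [|N sN] := @exprn_small R s (e / (B + 1)) s0 s1; first by rewrite divr_gt0.
  exists N => n Nn; have sn : s ^+ n <= s ^+ N by rewrite ler_wiXn2l// ltW.
  rewrite ler_pdivlMr// in sN.
  by have := SB n; have := exprn_ge0 n s0; have := exprn_ge0 N s0; nra.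
(* The infimum [s0] of this set is the spectral radius; were it below 1, the powers of T would tend
   to 0. *)
pose E : set R := [set s | 0 < s /\ exists B : R, forall n, `|T ^+ n| <= B * s ^+ n].
have E1 s : E s -> 1 <= s.
  move=> [s0 [B sB]]; rewrite leNgt; apply/negP => s1; apply: Tn0.
  exact: geo0 (ltW s0) s1 sB.
have hE : has_inf E.
  split; last by exists 1 => s /E1.
  exists (1 + `|T|); split; first by rewrite ltr_wpDr.
  exists 1 => n; rewrite mul1r (le_trans (bop_normX _ _))//.
  by rewrite lerXn2r// ?nnegrE ?addr_ge0// lerDr.
pose s0 := inf E.
have s01 : 1 <= s0 by apply: lb_le_inf; [case: hE|move=> s /E1].
have s0p : 0 < s0 by exact: lt_le_trans s01.
pose T' := s0^-1 *: T.
have T'n n : `|T' ^+ n| = `|T ^+ n| / s0 ^+ n.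
  by rewrite bop_exprZ normrZ ger0_norm ?exprn_ge0 ?invr_ge0 ?ltW// mulrC exprVn.
have T'sub : subexponential (fun n => `|T' ^+ n|).
  move=> e e0; have d0 : 0 < s0 * e by rewrite mulr_gt0.
  have [s [sp [B sB]] se] := inf_adherent d0 hE.
  exists B => n; rewrite T'n ler_pdivrMr ?exprn_gt0//.
  have B0 : 0 <= B by have := sB 0%N; rewrite !expr0 mulr1; apply: le_trans.
  rewrite (le_trans (sB n))// -mulrA ler_wpM2l// -exprMn lerXn2r// ?nnegrE.
  - exact: ltW.
  - by rewrite mulr_ge0// ltW// ltr_wpDl.
  - by rewrite (le_trans (ltW se))// /s0; lra.
have T'0 : ~ powers_to0 T'.
  move=> T'0; have h0 : 0 < 2^-1 :> R by lra.
  have [N hN] := T'0 _ h0.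
  have [|n m|||s [B [sp s1 sB]]] :=
    @submultiplicative_decay R (fun n => `|T' ^+ n|) N.+1.
  - by [].
  - by rewrite exprD bop_normM.
  - by [].
  - exact: hN.
  have : E (s0 * s).
    split; first by rewrite mulr_gt0.
    exists B => n; have := sB n; rewrite T'n ler_pdivrMr ?exprn_gt0// exprMn.
    by rewrite -mulrA (mulrC (s ^+ n)).
  move=> Es; have : s0 <= s0 * s by apply: ge_inf => //; case: hE.
  by rewrite ler_pMr// leNgt s1.
have T'k : ess_le k T'.
  apply: ess_leW (ess_leZ s0^-1 Tk).
  have k0 : 0 <= k by case: Tk => K _; apply: le_trans.
  by rewrite gtr0_norm ?invr_gt0// ler_pdivrMl// ler_peMl.
have [[P [u [PT P0 u0 Pu]]]|] := subexponential_powers_dichotomy T'k k1 T'sub T'0.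
  left; exists P, u; split=> // S ST; apply: PT.
  by rewrite -bop_scaleAr -bop_scaleAl ST.
by right.
Qed.

End PowerLimits.

(** * Hilden's argument *)

Section Words.
Variables (R : realType) (X : completeNormedModType R).
Implicit Types S T t : bop X X.
Implicit Types w ts : seq (bop X X).

Definition word_prod w : bop X X := foldr (fun t P => t * P) 1 w.

Lemma word_prod_split w t : (forall u, u \in w -> u * t = t * u) ->
  word_prod w = t ^+ count_mem t w * word_prod [seq u <- w | u != t].
Proof.
elim: w => [|u w ih] tw; first by rewrite /= mul1r.
have {}ih := ih (fun v vw => tw v (mem_behead (s := u :: w) vw)).
rewrite /= ih; have [->|ut] := eqVneq u t; first by rewrite mulrA -exprS.
rewrite /= mulrA add0n mulrA; congr (_ * _).
by apply: commrX; apply: tw; rewrite mem_head.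
Qed.

(** In a long word either the first letter t of the list occurs often or the subword without t is
    long. Commutativity separates the two parts, and each is uniformly bounded while the other is
    small. *)
Lemma word_prod_to0 ts : (forall t, t \in ts -> powers_to0 t) ->
  (forall t u, t \in ts -> u \in ts -> t * u = u * t) ->
  (exists M : R, forall w, {subset w <= ts} -> `|word_prod w| <= M) /\
  forall e : R, 0 < e -> exists N, forall w, {subset w <= ts} ->
    (N <= size w)%N -> `|word_prod w| <= e.
Proof.
elim: ts => [|t ts ih] t0 tC.
  have nil w : {subset w <= [::]} -> w = [::].
    by case: w => [//|u w] /(_ u (mem_head u w)); rewrite in_nil.
  split; first by exists 1 => w /nil->; exact: bop_norm1.
  by move=> e _; exists 1%N => w /nil->.
have [||[M wM] w0] := ih.
- by move=> u uts; apply: t0; rewrite inE uts orbT.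
- by move=> u v uts vts; apply: tC; rewrite inE ?uts ?vts orbT.
have [M' tM] : exists M' : R, forall n, `|t ^+ n| <= M'.
  have [N tN] := t0 t (mem_head t ts) 1 ltr01.
  have [n _ nmax] := exists_max_upto (fun n => `|t ^+ n|) N.
  exists (1 + `|t ^+ n|) => k; have [kN|/ltnW kN] := leqP k N.
    by rewrite (le_trans (nmax k kN))// lerDr.
  by rewrite (le_trans (tN k kN))// lerDl.
have M0 : 0 <= M by apply: le_trans (wM [::] _).
have M'0 : 0 <= M' by apply: le_trans (tM 0%N).
have split_word w : {subset w <= t :: ts} -> exists2 w', {subset w' <= ts} &
    word_prod w = t ^+ (size w - size w') * word_prod w' /\ (size w' <= size w)%N.
  move=> wts; exists [seq u <- w | u != t].
    by move=> u; rewrite mem_filter /= => /andP[ut /wts]; rewrite inE (negbTE ut).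
  split; last by rewrite size_filter count_size.
  rewrite {1}(word_prod_split (t := t)); last first.
    by move=> u /wts uw; apply: tC => //; exact: mem_head.
  congr (_ ^+ _ * _); rewrite size_filter -(count_predC (pred1 t) w).
  by rewrite (_ : count (fun u => u != t) w = count (predC (pred1 t)) w)// addnK.
split.
  exists (M' * M) => w /split_word[w' w'ts [-> _]].
  by rewrite (le_trans (bop_normM _ _))// ler_pM// wM.
move=> e e0; have [|N1 tN1] := t0 t (mem_head t ts) (e / (1 + M)).
  by rewrite divr_gt0// ltr_wpDr.
have [|N2 wN2] := w0 (e / (1 + M')); first by rewrite divr_gt0// ltr_wpDr.
exists (N1 + N2)%N => w /split_word[w' w'ts [-> w'w]] Nw.
rewrite (le_trans (bop_normM _ _))//.
have [h|h] := leqP N2 (size w').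
  have := wN2 w' w'ts h; rewrite ler_pdivlMr ?ltr_wpDr// => h1.
  rewrite (le_trans _ h1)// mulrC ler_wpM2l//.
  by rewrite (le_trans (tM _))// lerDr.
have := tN1 (size w - size w')%N; rewrite ler_pdivlMr ?ltr_wpDr// => h1.
rewrite (le_trans _ (h1 _))//; last first.
  by rewrite leq_subRL// (leq_trans _ Nw)// addnC leq_add2l ltnW.
by rewrite ler_wpM2l// (le_trans (wM _ _))// lerDr.
Qed.

End Words.

Section WeakStar.
Variables (R : realType) (X : normedModType R).

(** Banach-Alaoglu in ultrafilter form: the values y x stay in a compact interval, and their limits
    along U form a functional in the same ball. *)
Lemma ultra_weak_star_limit (U : set_system (dual X)) (UU : UltraFilter U)
    (y0 : dual X) (r : R) : U [set y | `|y - y0| <= r] ->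
  exists f : dual X, `|f - y0| <= r /\
    forall x (e : R), 0 < e -> U [set y : dual X | `|y x - f x| <= e].
Proof.
move=> Ur.
have r0 : 0 <= r by have [y /=] := filter_ex Ur; apply: le_trans.
have lim x : exists c : R, forall e : R, 0 < e -> U [set y : dual X | `|(y x : R) - c| <= e].
  pose ev (y : dual X) : R := y x.
  have := @segment_compact R ((y0 x : R) - r * `|x|) ((y0 x : R) + r * `|x|).
  move=> /(_ (fmap ev U) _)[|c [_ cl]].
    change (U (ev @^-1` [set` `[((y0 x : R) - r * `|x|), ((y0 x : R) + r * `|x|)]])).
    apply: filterS Ur => y /= yr; rewrite in_itv /= -ler_distl.
    by rewrite (le_trans (ler_bop (y - y0) x))// ler_wpM2r.
  exists c => e e0; have [//|Un] := in_ultra_setVsetC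
    [set y : dual X | `|(y x : R) - c| <= e] UU.
  have [||z []] := cl [set z | ~ `|z - c| <= e] (ball c e).
  - exact: Un.
  - exact: nbhsx_ballx.
  - by rewrite -ball_normE /= distrC => h /ltW.
have [f fP] := choice lim.
have fl : linear (f : X -> R^o).
  move=> a x y; apply/eqP; rewrite -subr_eq0 -normr_le0.
  apply/ler_addgt0Pr => e e0; pose d := e / (2 + `|a|).
  have a0 : 0 < 2 + `|a| by rewrite ltr_wpDr.
  have d0 : 0 < d by rewrite divr_gt0.
  have [z [/= [z1 z2] z3]] :=
    filter_ex (filterI (filterI (fP (a *: x + y) d d0) (fP x d d0)) (fP y d d0)).
  have zE : (z (a *: x + y) : R) = a * z x + z y by rewrite linearP.
  change (`|(f (a *: x + y) : R) - (a * f x + f y)| <= 0 + e).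
  rewrite add0r (_ : _ - _ = a * ((z x : R) - f x) + ((z y : R) - f y)
      - ((z (a *: x + y) : R) - f (a *: x + y))); last first.
    by rewrite zE; ring.
  have : `|a * ((z x : R) - f x)| <= `|a| * d by rewrite normrM ler_wpM2l.
  have : d * (2 + `|a|) <= e by rewrite divfK// gt_eqF.
  have := ler_normB (a * ((z x : R) - f x) + ((z y : R) - f y))
    ((z (a *: x + y) : R) - f (a *: x + y)).
  have := ler_normD (a * ((z x : R) - f x)) ((z y : R) - f y).
  by lra.
have fr x : `|f x - y0 x| <= r * `|x|.
  apply/ler_addgt0Pr => e e0; have [y [/= yr yf]] := filter_ex (filterI Ur (fP x e e0)).
  rewrite -(subrKA (y x)) (le_trans (ler_normD _ _))// addrC lerD//.
    by rewrite (le_trans (ler_bop (y - y0) x))// ler_wpM2r.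
  by rewrite distrC.
have [g gf] : exists g : bop X R^o, forall x, g x = f x.
  apply: (@bop_exists R X R^o f (r + `|y0|) fl) => x.
  rewrite -(subrK (y0 x : R) (f x)) (le_trans (ler_normD _ _))// mulrDl lerD//.
  exact: ler_bop.
exists g; split; first by apply: bop_norm_le => // x; rewrite bopBE gf.
by move=> x e e0; rewrite gf; exact: fP.
Qed.

End WeakStar.

Section Unitization.
Variables (R : realType) (X : normedModType R).
Implicit Types (A : set (bop X X)) (S T : bop X X).

Definition unitization A : set (bop X X) :=
  [set T | exists (a : R) S, A S /\ T = a *: (1 : bop X X) + S].

Variable A : set (bop X X).
Hypothesis algA : commutative_algebra A.

Let A0 : A 0. Proof. by case: algA. Qed.
Let AL : forall (a : R) S T, A S -> A T -> A (a *: S + T). Proof. by case: algA. Qed.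
Let AM : forall S T, A S -> A T -> A (S * T). Proof. by case: algA. Qed.
Let AC : forall S T, A S -> A T -> S * T = T * S. Proof. by case: algA. Qed.

Lemma algebraZ (a : R) S : A S -> A (a *: S).
Proof. by move=> AS; rewrite -[a *: S]addr0; exact: AL. Qed.

Lemma algebraD S T : A S -> A T -> A (S + T).
Proof. by move=> AS AT; rewrite -[S]scale1r; exact: AL. Qed.

Lemma sub_unitization S : A S -> unitization A S.
Proof. by exists 0, S; split=> //; rewrite scale0r add0r. Qed.

Lemma unitization1 : unitization A 1.
Proof. by exists 1, 0; split=> //; rewrite scale1r addr0. Qed.

Lemma unitizationZ (a : R) S : unitization A S -> unitization A (a *: S).
Proof.
move=> [b [S' [AS ->]]]; exists (a * b), (a *: S'); split; first exact: algebraZ.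
by rewrite scalerDr scalerA.
Qed.

Lemma unitizationD S T : unitization A S -> unitization A T -> unitization A (S + T).
Proof.
move=> [a [S' [AS ->]]] [b [T' [AT ->]]]; exists (a + b), (S' + T').
by split; [exact: algebraD|rewrite addrACA scalerDl].
Qed.

Lemma unitizationB S T : unitization A S -> unitization A T -> unitization A (S - T).
Proof.
by move=> US UT; rewrite -scaleN1r; apply: unitizationD => //; exact: unitizationZ.
Qed.

Lemma unitizationMl S T : A S -> unitization A T -> A (S * T).
Proof.
move=> AS [b [T' [AT ->]]]; rewrite mulrDr -bop_scaleAr mulr1.
by apply: algebraD; [exact: algebraZ|exact: AM].
Qed.

Lemma unitizationM S T : unitization A S -> unitization A T -> unitization A (S * T).
Proof.
move=> [a [S' [AS ->]]] UT; rewrite mulrDl -bop_scaleAl mul1r.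
apply: unitizationD; first exact: unitizationZ.
by apply: sub_unitization; exact: unitizationMl.
Qed.

Lemma unitization_commute_sub S T : A S -> unitization A T -> S * T = T * S.
Proof.
move=> AS [b [T' [AT ->]]].
by rewrite mulrDl mulrDr -bop_scaleAl -bop_scaleAr mulr1 mul1r AC.
Qed.

Lemma unitization_commute S T : unitization A S -> unitization A T -> S * T = T * S.
Proof.
move=> [a [S' [AS ->]]] UT.
by rewrite mulrDl mulrDr -bop_scaleAl -bop_scaleAr mulr1 mul1r unitization_commute_sub.
Qed.

End Unitization.

Section Hilden.
Variables (R : realType) (X : completeNormedModType R).
Variable A : set (bop X X).
Hypothesis dimX : dim_ge X 3.
Hypothesis algA : commutative_algebra A.
Hypothesis noinv : ~ dual_invariant_subspace A.

Lemma unitization_powers_to0 (k : R) T : unitization A T -> ess_le k T -> k < 1 ->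
  powers_to0 T.
Proof.
move=> UT Tk k1; apply: contrapT => T0; apply: noinv.
have [[P [u [PT P0 u0 Pu]]]|[K [c [cK Kc c1]]]] := powers_dichotomy Tk k1 T0.
  apply: (dual_invariant_of_noninjective _ P0 u0 Pu) => S AS; apply: PT.
  exact: (unitization_commute_sub algA).
have [m [g gX]] := compact_near_id_span cK Kc c1.
exact: finite_dim_dual_invariant gX.
Qed.

(* Hilden's argument: otherwise finitely many elements of the algebra with small
   essential norm would suffice to keep, by iteration, a point inside a ball
   which does not contain 0, although their powers tend to 0. *)
Lemma exists_nondense_orbit : exists (y g : dual X) (e d : R),
  [/\ y <> 0, 0 < e, 0 < d &
  forall T, unitization A T -> ess_le d T -> e < `|adjoint T y - g|].
Proof.
apply: contrapT => dense.
have {}dense (y g : dual X) (e d : R) : y <> 0 -> 0 < e -> 0 < d ->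
    exists T, [/\ unitization A T, ess_le d T & `|adjoint T y - g| <= e].
  move=> y0 e0 d0; apply: contrapT => h; apply: dense; exists y, g, e, d.
  split=> // T UT Td; rewrite ltNge; apply/negP => Te; apply: h.
  by exists T.
(* Norm 2 keeps 0 out of the ball of radius 1 about [y0]. *)
have [y0 y02] : exists y0 : dual X, `|y0| = 2.
  have [y y0 _] := @dim_ge_kernel R (dual X) 3 0 (fun=> 0) isT (dim_ge_dual dimX).
  have ny : 0 < `|y| by rewrite normr_gt0; apply/eqP.
  exists ((2 / `|y|) *: y); rewrite normrZ gtr0_norm ?divr_gt0//.
  by rewrite divfK// gt_eqF.
have q0 : 0 < 4^-1 :> R by lra.
have pick (y : dual X) : exists T, [/\ unitization A T, ess_le 4^-1 T &
    y <> 0 -> `|adjoint T y - y0| <= 4^-1].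
  have [->|y0'] := eqVneq y 0.
    exists 0; split=> //; first by apply: sub_unitization => //; case: algA.
    by apply: ess_leW (ess_le_norm _); rewrite normr0 ltW.
  have [|T [UT Te Ty]] := dense y y0 4^-1 4^-1 _ q0 q0; first exact/eqP.
  by exists T.
have [T TP] := choice pick.
(* The operator [T f] returns to the ball every point of it that is weak* close to f. The radius 1
   is shared between 1/4 for the image of f, 1/4 for a compact approximation of [T f], controlled at
   finitely many points, and 1/2 for the remainder, of norm at most 1/4, on a difference of norm at
   most 2. *)
have [|s sP] := @ultra_cover (dual X) (dual X) [set y | `|y - y0| <= 1]
    (fun i => [set y | `|y - y0| <= 1 -> `|adjoint (T i) y - y0| <= 1]).
  move=> U UU UK; have [f [fK fU]] := ultra_weak_star_limit UU UK.
  exists f; have [_ [C cC TC] Tf] := TP f.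
  have f0 : f <> 0.
    by move=> f0; move: fK; rewrite f0 sub0r normrN y02; lra.
  have e0 : 0 < 4^-1 / 4 :> R by rewrite divr_gt0.
  have [s sC] := compact_op_net cC e0.
  have d0 : 0 < 4^-1 / 2 :> R by rewrite divr_gt0.
  have Us : U [set y : dual X | forall p, p \in s -> `|y p - f p| <= 4^-1 / 2].
    by apply: (@filter_finite_inter _ X U _ s (fun p => [set y : dual X | `|y p - f p| <= 4^-1 / 2])) => p _; exact: fU.
  apply: filterS (filterI UK Us) => y [/= yK ys] _.
  have yf : `|y - f| <= 2.
    apply: (le_trans (ler_distD y0 y f)); rewrite [leRHS](_ : 2 = 1 + 1); last by [].
    by apply: lerD; [exact: yK|rewrite distrC; exact: fK].
  have Cyf : `|adjoint C (y - f)| <= 4^-1.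
    apply: op_norm_le => x x1; rewrite adjointE.
    have [p ps Cp] := sC x x1.
    rewrite -(subrK p (C x)) linearD (le_trans (ler_normD _ _))//.
    have h1 : `|(y - f) (C x - p)| <= 2 * (4^-1 / 4).
      by rewrite (le_trans (ler_bop _ _))// ler_pM.
    have h2 : `|(y - f) p| <= 4^-1 / 2 by exact: ys.
    by rewrite (le_trans (lerD h1 h2))// [leLHS](_ : _ = 4^-1)//; field.
  have Ryf : `|adjoint (T f - C) (y - f)| <= 4^-1 * 2.
    by rewrite (le_trans (ler_adjoint _ _))// ler_pM.
  rewrite (_ : adjoint (T f) y - y0 = (adjoint (T f) f - y0) +
      (adjoint C (y - f) + adjoint (T f - C) (y - f))); last first.
    rewrite -adjointDl [C + _]addrC subrK (linearB (adjoint (T f))) /=.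
    by rewrite [RHS]addrC addrA subrK.
  have h := le_trans (ler_normD _ _) (lerD Cyf Ryf).
  rewrite (le_trans (le_trans (ler_normD _ _) (lerD (Tf f0) h)))//.
  by rewrite [leLHS](_ : _ = 1)//; field.
have words n : exists w, [/\ size w = n, {subset w <= map T s},
    unitization A (word_prod w) & `|adjoint (word_prod w) y0 - y0| <= 1].
  elim: n => [|n [w [wn ws Uw wy]]].
    exists [::]; split=> //; first exact: unitization1.
    by rewrite adjoint1 subrr normr0.
  have [i si /(_ wy) Ti] := sP _ wy; have [UT _ _] := TP i.
  exists (T i :: w); split.
  - by rewrite /= wn.
  - move=> t; rewrite inE => /orP[/eqP->|/ws//]; exact: map_f.
  - exact: unitizationM.
  - rewrite (_ : word_prod (T i :: w) = word_prod w * T i) ?adjointM//.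
    exact: (unitization_commute algA UT Uw).
have [||_ w0] := @word_prod_to0 R X (map T s).
- move=> t /mapP[i _ ->]; have [UT Ti _] := TP i.
  by apply: (unitization_powers_to0 UT Ti); lra.
- move=> t u /mapP[i _ ->] /mapP[j _ ->].
  by apply: (unitization_commute algA); [have [] := TP i|have [] := TP j].
have [N wN] := w0 _ q0; have [w [wn ws _ wy]] := words N.
have := wN w ws; rewrite wn leqnn => /(_ isT) h.
have h1 : `|adjoint (word_prod w) y0| <= 4^-1 * 2.
  by rewrite (le_trans (ler_adjoint _ _))// y02 ler_wpM2r.
have := ler_normB y0 (y0 - adjoint (word_prod w) y0).
have := ler_distD (adjoint (word_prod w) y0) y0 0.
by rewrite !subr0 y02 (distrC y0); lra.
Qed.

End Hilden.

(** * Positive functionals *)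

Section EssentialOrbit.
Variables (R : realType) (X : normedModType R).
Variable A : set (bop X X).
Hypothesis algA : commutative_algebra A.
Implicit Types (S T Q : bop X X) (y z : dual X).

(* The norm closure of {T^* y : T in A + R 1, |T|_e < 1}. *)
Definition ess_orbit y : set (dual X) := [set z | forall e : R, 0 < e ->
  exists T (c : R), [/\ unitization A T, ess_le c T, c < 1 & `|z - adjoint T y| <= e]].

Lemma mem_ess_orbit y T (c : R) : unitization A T -> ess_le c T -> c < 1 ->
  ess_orbit y (adjoint T y).
Proof. by move=> UT Tc c1 e e0; exists T, c; split=> //; rewrite subrr normr0 ltW. Qed.

Lemma ess_orbit0 y : ess_orbit y 0.
Proof.
have A0 : A 0 by case: algA.
rewrite -(adjoint0 y); apply: (@mem_ess_orbit _ _ 0) => //.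
  exact: sub_unitization.
by apply: ess_leW (ess_le_norm _); rewrite normr0.
Qed.

Lemma ess_orbit_closed y : norm_closed (ess_orbit y).
Proof.
move=> z Wz e e0; have e20 : 0 < e / 2 by rewrite divr_gt0.
have [v Wv zv] := Wz _ e20; have [T [c [UT Tc c1 vT]]] := Wv _ e20.
exists T, c; split=> //; rewrite (le_trans (ler_distD v _ _))//.
by rewrite (splitr e) lerD.
Qed.

Lemma ess_orbit_convex y : is_convex (ess_orbit y).
Proof.
move=> z1 z2 t t0 t1 W1 W2 e e0.
have [T1 [c1 [UT1 Tc1 c11 zT1]]] := W1 e e0.
have [T2 [c2 [UT2 Tc2 c21 zT2]]] := W2 e e0.
have s0 : 0 <= 1 - t by rewrite subr_ge0.
have cvx (a b d : R) : a <= d -> b <= d -> t * a + (1 - t) * b <= d.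
  by move=> /(ler_wpM2l t0) ad /(ler_wpM2l s0) bd; move: ad bd; clear; lra.
pose c := Num.max c1 c2.
exists (t *: T1 + (1 - t) *: T2), c; split.
- by apply: unitizationD => //; exact: unitizationZ.
- apply: ess_leW (ess_leD (ess_leZ t Tc1) (ess_leZ (1 - t) Tc2)).
  by rewrite !ger0_norm// cvx// /c le_max lexx ?orbT.
- by rewrite /c gt_max c11.
- rewrite adjointDl !adjointZl opprD addrACA -!scalerBr.
  rewrite (le_trans (ler_normD _ _))// !normrZ !ger0_norm//; exact: cvx.
Qed.

(** If T has essential norm at most b < 1, then so has c^-1 T Q. With Q = 1 - e S^2 this is the
    passage from W to (1 + o(e)) W. *)
Lemma ess_orbit_adjoint y z Q (c : R) : 0 < c -> unitization A Q -> ess_le c Q ->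
  ess_orbit y z -> ess_orbit y (c^-1 *: adjoint Q z).
Proof.
move=> c0 UQ Qc Wz e e0.
have D0 : 0 < 1 + `|Q| by rewrite ltr_wpDr.
have [|T [b [UT Tb b1 zT]]] := Wz (e * c / (1 + `|Q|)).
  by rewrite divr_gt0// mulr_gt0.
exists (c^-1 *: (T * Q)), b; split; [| |exact: b1|].
- by apply: unitizationZ => //; exact: unitizationM.
- apply: ess_leW (ess_leZ _ (ess_leM Tb Qc)).
  by rewrite gtr0_norm ?invr_gt0// mulrC mulfK// gt_eqF.
- rewrite adjointZl -scalerBr adjointM -linearB normrZ gtr0_norm ?invr_gt0//.
  rewrite ler_pdivrMl// (le_trans (ler_adjoint _ _))// mulrC.
  rewrite ler_pdivlMr// in zT; rewrite mulrC -(mulrC e) (le_trans _ zT)//.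
  by rewrite mulrC ler_wpM2l// lerDr.
Qed.

(** Up to a positive factor the orbit contains every T^* y, so a functional that is at most 0 on the
    orbit vanishes on all of them. *)
Lemma ess_orbit_scaled y T : unitization A T ->
  exists2 k : R, 0 < k & ess_orbit y (k *: adjoint T y).
Proof.
move=> UT; pose k := (2 * (1 + `|T|))^-1.
have k0 : 0 < k by rewrite invr_gt0 mulr_gt0// ltr_wpDr.
exists k => //; rewrite -adjointZl; apply: (@mem_ess_orbit _ _ `|k *: T|).
- exact: unitizationZ.
- exact: ess_le_norm.
- rewrite normrZ gtr0_norm// /k ltr_pdivrMl ?mulr_gt0 ?ltr_wpDr// mulr1.
  by have := normr_ge0 T; lra.
Qed.

End EssentialOrbit.

Section PositiveFunctional.
Variables (R : realType) (X : completeNormedModType R).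
Variable A : set (bop X X).
Hypothesis dimX : dim_ge X 3.
Hypothesis algA : commutative_algebra A.
Hypothesis noinv : ~ dual_invariant_subspace A.

Lemma essentially_real_ess_le (S : bop X X) (e : R) : essentially_real S -> 0 < e ->
  exists2 d : R, 0 < d & ess_le (1 + d * e) (1 - d *: S ^+ 2).
Proof.
move=> [r /eqoP ro Sr] e0.
have e20 : 0 < e / 2 by rewrite divr_gt0.
have rnear : \forall d \near 0^'+, `|r d| <= e / 2 * `|d| by exact: ro.
have near0 : \forall d \near 0^'+, 0 < d :> R by exact: nbhs_right_gt.
have [d [[/= rd Sd] d0]] :=
  @filter_ex _ _ (at_right_proper_filter 0) _ (filterI (filterI rnear Sr) near0).
exists d; first exact: d0.
apply: ess_norm_lt; rewrite (le_lt_trans Sd)// ltrD2l.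
rewrite (le_lt_trans (ler_norm _))// (le_lt_trans rd)// gtr0_norm//.
by rewrite mulrC ltr_pM2l// ltr_pdivrMr// ltr_pMr// ltr1n.
Qed.

Lemma exists_proper_ess_orbit :
  exists (y p : dual X), y <> 0 /\ ~ ess_orbit A y p.
Proof.
have [y [g [e [d [y0 e0 d0 yT]]]]] := exists_nondense_orbit dimX algA noinv.
exists y, (d^-1 *: g); split; first exact: y0.
move=> /(_ (e / d))[|T [c [UT Tc c1 gT]]]; first by rewrite divr_gt0.
have dT : ess_le d (d *: T).
  by apply: ess_leW (ess_leZ d Tc); rewrite gtr0_norm// ler_piMr ?ltW.
have := yT (d *: T) (unitizationZ algA d UT) dT.
rewrite adjointZl (_ : d *: adjoint T y - g = - (d *: (d^-1 *: g - adjoint T y))).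
  by rewrite normrN normrZ gtr0_norm// -ltr_pdivrMl// mulrC ltNge gT.
by rewrite scalerBr scalerA divff ?scale1r ?opprB// gt_eqF.
Qed.

Lemma support_point_positive (y w : dual X) (x : dual (dual X)) (S : bop X X) :
  A S -> essentially_real S -> ess_orbit A y w ->
  (forall z, ess_orbit A y z -> (x z : R) <= x w) ->
  0 <= (x (adjoint (S ^+ 2) w) : R).
Proof.
move=> AS realS Ww xW.
have xw0 : 0 <= (x w : R) by have := xW 0 (ess_orbit0 algA y); rewrite linear0.
apply/ler_addgt0Pr => n n0.
have xw1 : 0 < 1 + (x w : R) by rewrite ltr_wpDr.
(* With this m, the error m <x, w> left after division by t is at most n. *)
pose m := n / (1 + (x w : R)).
have m0 : 0 < m by rewrite divr_gt0.
have [t t0 St] := essentially_real_ess_le realS m0.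
pose Q : bop X X := 1 - t *: S ^+ 2.
have UQ : unitization A Q.
  apply: (unitizationB algA (unitization1 algA)); apply: (unitizationZ algA).
  by apply: sub_unitization; rewrite expr2; case: algA => _ _ h _; exact: h.
have c0 : 0 < 1 + t * m by rewrite ltr_wpDr// mulr_ge0// ltW.
have : (1 + t * m)^-1 * (x (adjoint Q w) : R) <= x w.
  by have := xW _ (ess_orbit_adjoint algA c0 UQ St Ww); rewrite linearZ.
rewrite ler_pdivrMl//.
have -> : (x (adjoint Q w) : R) = x w - t * x (adjoint (S ^+ 2) w).
  by rewrite adjointBl adjoint1 adjointZl linearB/= linearZ.
set a := (x (adjoint _ w) : R) => h.
have : t * - a <= t * (m * x w) by lra.
rewrite ler_pM2l// => h1.
have : m * (1 + (x w : R)) = n by rewrite /m divfK// gt_eqF.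
by lra.
Qed.

Lemma exists_positive_functional : (forall T, A T -> essentially_real T) ->
  exists (x : dual (dual X)) (w : dual X),
  [/\ x <> 0, w <> 0 & forall S, A S -> 0 <= (x (adjoint (S ^+ 2) w) : R)].
Proof.
move=> realA; have [y [p [y0 Wp]]] := exists_proper_ess_orbit.
have [w [x [Ww _ x0 xW]]] := bishop_phelps (@dual_cauchy_complete R X)
  (@ess_orbit_closed R X A y) (ess_orbit_convex algA (y := y)) (ess_orbit0 algA y) Wp.
exists x, w; split; first exact: x0; last first.
  by move=> S AS; apply: support_point_positive AS (realA S AS) Ww xW.
(* If w were 0, x would be at most 0 on the orbit; applied to S T and -S T, this makes x annihilate
   every (S T)^* y. *)
move=> w0; apply: noinv; apply: (dual_invariant_of_annihilated dimX algA x0 y0).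
move=> S T AS AT.
have xle (P : bop X X) : unitization A P -> (x (adjoint P y) : R) <= 0.
  move=> UP; have [k k0 /xW] := ess_orbit_scaled algA y UP.
  by rewrite w0 linear0 linearZ /= (pmulr_rle0 _ k0).
have AST : unitization A (S * T).
  by apply: sub_unitization; case: algA => _ _ h _; exact: h.
have := xle _ (unitizationZ algA (-1) AST).
rewrite scaleN1r adjointNl linearN /= oppr_le0 => h.
by apply/eqP; rewrite eq_le h xle.
Qed.

End PositiveFunctional.

(** * The positive cone *)

Section ConeSupport.
Variables (R : realType) (V : normedModType R).

(* Bishop-Phelps is applied outside the cone but close to a point of the cone far
   from 0, so that the support point is not the vertex. *)
Lemma cone_support_point (C : set V) (x : dual V) (z0 v : V) :
  cauchy_complete V -> norm_closed C -> is_convex C -> C 0 ->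
  (forall (t : R) z, 0 <= t -> C z -> C (t *: z)) ->
  (forall z, C z -> 0 <= (x z : R)) -> x <> 0 -> C z0 -> z0 <> 0 -> v <> 0 -> x v = 0 ->
  exists (w : V) (f : dual V), [/\ C w, w <> 0, f <> 0,
    forall z, C z -> 0 <= (f z : R) & f w = 0].
Proof.
move=> cV nC cC C0 CZ xC x0 Cz0 z00 v0 xv.
have [Cv|nCv] := pselect (C v); first by exists v, x.
have [xz0|/eqP xz0] := pselect (x z0 = 0); first by exists z0, x.
have xz0p : 0 < (x z0 : R) by rewrite lt_neqAle eq_sym xz0 xC.
have nv : 0 < `|v| by rewrite normr_gt0; apply/eqP.
(* If all z0 + N v were in the cone, their multiples by 1 / N would converge to v, which is not in
   C. *)
have [N [N0 CN]] : exists N, (0 < N)%N /\ ~ C (z0 + N%:R *: v).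
  apply: contrapT => /forallNP h; apply: nCv; apply: nC => e e0.
  pose N := (Num.truncn (`|z0| / e)).+1.
  have N0 : 0 < N%:R :> R by rewrite ltr0n.
  have CN : C (z0 + N%:R *: v) by apply: contrapT => ?; apply: (h N).
  exists (N%:R^-1 *: (z0 + N%:R *: v)); first by apply: CZ CN; rewrite invr_ge0 ltW.
  rewrite scalerDr scalerA mulVf ?gt_eqF// scale1r opprD addrCA subrr addr0 normrN.
  rewrite normrZ gtr0_norm ?invr_gt0// ler_pdivrMl// -ler_pdivrMr//.
  by rewrite ltW// truncnS_gt.
have nx : 0 < `|x| by rewrite normr_gt0; apply/eqP.
(* The subdivision is fine enough for a step to have length h |v| < x z0 / |x|, which is at most the
   norm of any z0 + t v because x v = 0. *)
pose m := (Num.truncn (N%:R * `|v| * `|x| / x z0)).+1.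
have m0 : 0 < m%:R :> R by rewrite ltr0n.
pose h : R := N%:R / m%:R.
have hx : h * `|v| * `|x| < x z0.
  rewrite /h (_ : _ * `|x| = N%:R * `|v| * `|x| / m%:R); last first.
    by field; rewrite gt_eqF.
  by rewrite ltr_pdivrMr// [ltRHS]mulrC -ltr_pdivrMr//; exact: truncnS_gt.
have h0 : 0 < h by rewrite divr_gt0// ltr0n.
have [k [Ck nCk]] : exists k : nat, C (z0 + (k%:R * h) *: v) /\
    ~ C (z0 + (k.+1%:R * h) *: v).
  apply: contrapT => /forallNP H.
  have CC k : C (z0 + (k%:R * h) *: v).
    elim: k => [|k ih]; first by rewrite mul0r scale0r addr0.
    by apply: contrapT => ?; apply: (H k).
  by apply: CN; have := CC m; rewrite /h mulrC divfK// gt_eqF.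
set z := z0 + _ in Ck; set p := z0 + _ in nCk.
have zp : `|z - p| = h * `|v|.
  rewrite /z /p opprD addrACA subrr add0r -scalerBl normrZ -mulrBl -natr1.
  by rewrite opprD addrA subrr add0r mulN1r normrN gtr0_norm.
have xp : x p = x z0 by rewrite /p linearD linearZ /= xv scaler0 addr0.
have pz : `|z - p| < `|p|.
  rewrite zp; have : (x z0 : R) <= `|x| * `|p|.
    by rewrite -xp (le_trans (ler_norm _))// ler_bop.
  by rewrite mulrC => h2; rewrite -(ltr_pM2r nx) (lt_le_trans hx).
(* The support point is within |z - p| < |p| of p, so it is not 0. The maximum of f over the cone is
   0, as comparison with 0 and 2 w shows, so -f is nonnegative there. *)
have [w [f [Cw wp f0 fC]]] := bishop_phelps cV nC cC Ck nCk.
have fw : f w = 0.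
  have h1 : 0 <= (f w : R) by have := fC 0 C0; rewrite linear0.
  have := fC (2 *: w) (CZ 2 w (ler0n _ 2) Cw); rewrite linearZ /= => h2.
  have {}h2 : 2 * (f w : R) <= f w by [].
  by apply/eqP; rewrite eq_le h1 andbT; lra.
exists w, (- f); split.
- exact: Cw.
- by move=> w0; move: wp; rewrite w0 sub0r normrN leNgt pz.
- by move=> /eqP; rewrite oppr_eq0 => /eqP.
- by move=> z1 /fC; rewrite fw bopNE oppr_ge0.
- by rewrite bopNE fw oppr0.
Qed.

End ConeSupport.

Section RealLemmas.
Variable R : realType.

Lemma nonneg_quadratic (a b c : R) : 0 <= a -> 0 <= c ->
  (forall t : R, 0 <= a + 2 * t * b + t ^+ 2 * c) -> b ^+ 2 <= a * c.
Proof.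
move=> a0 c0 q; have [c00|cn0] := eqVneq c 0.
  have [->|bn0] := eqVneq b 0; first by rewrite expr0n mulr_ge0.
  have := q (- (a + 1) / (2 * b)); rewrite c00 mulr0 addr0.
  rewrite (_ : 2 * _ * b = - (a + 1)); first by lra.
  by field.
have cp : 0 < c by rewrite lt_neqAle eq_sym cn0.
have := q (- b / c); rewrite (_ : _ + _ = a - b ^+ 2 / c); last by field.
by rewrite subr_ge0 ler_pdivrMr.
Qed.

(** If d 0 > be s^2 with be > 0, the recursion gives d n > be s^(2^(n+1)) for all n, which outgrows
    G r^(2^(n+1)) since r < s. *)
Lemma log_convex_bound (be G s r : R) (d : nat -> R) :
  0 <= be -> 0 <= G -> 0 <= r -> r < s -> (forall n, d n ^+ 2 <= be * d n.+1) ->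
  (forall n, d n <= G * r ^+ (2 ^ n.+1)) -> d 0 <= be * s ^+ 2.
Proof.
move=> be0 G0 r0 rs dC dG; rewrite leNgt; apply/negP => d0.
have s0 : 0 < s by exact: le_lt_trans rs.
have [bez|ben0] := eqVneq be 0.
  have := dC 0%N; rewrite bez mul0r => h.
  have : 0 < d 0 by rewrite bez mul0r in d0.
  by move=> /(exprn_gt0 2); rewrite ltNge h.
have bep : 0 < be by rewrite lt_neqAle eq_sym ben0.
have dlow n : be * s ^+ (2 ^ n.+1) < d n.
  elim: n => [//|n ih].
  have sn : 0 < s ^+ (2 ^ n.+1) by rewrite exprn_gt0.
  rewrite -(ltr_pM2l bep) (lt_le_trans _ (dC n))//.
  rewrite expnS mulnC exprM mulrA -expr2 -exprMn ltrXn2r// ?nnegrE.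
  by rewrite mulr_ge0// ltW.
have q0 : 0 <= r / s by rewrite divr_ge0// ltW.
have q1 : r / s < 1 by rewrite ltr_pdivrMr// mul1r.
have [|N qN] := exprn_small q0 q1 (e := be / (G + 1)).
  by rewrite divr_gt0// ltr_wpDl.
have qq : (r / s) ^+ (2 ^ N.+1) <= (r / s) ^+ N.
  by rewrite ler_wiXn2l ?(ltW q1)// (leq_trans _ (ltnW (ltn_expl _ _)))// leqW.
have := lt_le_trans (dlow N) (dG N).
rewrite -ltr_pdivlMr ?exprn_gt0// -mulrA -expr_div_n => h.
rewrite ler_pdivlMr in qN; last by rewrite ltr_wpDl.
have qq0 := exprn_ge0 (2 ^ N.+1) q0.
have : G * (r / s) ^+ (2 ^ N.+1) <= G * (r / s) ^+ N by rewrite ler_wpM2l.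
have := exprn_ge0 N q0.
move: h qN; set u := (r / s) ^+ N; set u' := (r / s) ^+ _ => h qN.
by clear -h qN; lra.
Qed.

End RealLemmas.

Section PositiveCone.
Variables (R : realType) (X : normedModType R).
Variable A : set (bop X X).
Hypothesis algA : commutative_algebra A.
Variable x : dual (dual X).
Implicit Types (z : dual X) (S T b c : bop X X).

(** For z in the cone below, this is a positive functional of b on the commutative algebra A + R
    1. *)
Let psi z b : R := x (adjoint b z).

Let psiD z b c : psi z (b + c) = psi z b + psi z c.
Proof. by rewrite /psi adjointDl linearD. Qed.

Let psiZ z (t : R) b : psi z (t *: b) = t * psi z b.
Proof. by rewrite /psi adjointZl linearZ. Qed.

Let psiM z b c : psi (adjoint b z) c = psi z (b * c).
Proof. by rewrite /psi adjointM. Qed.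

Let psiDr z1 z2 b : psi (z1 + z2) b = psi z1 b + psi z2 b.
Proof. by rewrite /psi (linearD (adjoint b)) linearD. Qed.

Let psiZr (t : R) z b : psi (t *: z) b = t * psi z b.
Proof.
have -> : psi (t *: z) b = x (t *: adjoint b z) by rewrite -linearZ.
exact: linearZ.
Qed.

Let psi_le z b : psi z b <= `|x| * `|z| * `|b|.
Proof.
rewrite (le_trans (ler_norm _))// (le_trans (ler_bop _ _))// -mulrA ler_wpM2l//.
by rewrite mulrC ler_adjoint.
Qed.

(** Squares are taken from A + R 1 so that b = 1 puts the cone in the half-space where x is
    nonnegative. *)
Definition positive_cone : set (dual X) :=
  [set z | forall b, unitization A b -> 0 <= (x (adjoint (b * b) z) : R)].

Lemma positive_cone0 : positive_cone 0.
Proof. by move=> b _; rewrite (linear0 (adjoint (b * b))) linear0. Qed.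

Lemma positive_cone_ge0 z : positive_cone z -> 0 <= (x z : R).
Proof.
by move=> /(_ 1 (unitization1 algA)); rewrite mulr1 adjoint1.
Qed.

Lemma positive_coneZ (t : R) z : 0 <= t -> positive_cone z -> positive_cone (t *: z).
Proof.
move=> t0 Cz b Ub; have := psiZr t z (b * b); rewrite /psi => ->.
by apply: mulr_ge0 => //; exact: Cz.
Qed.

Lemma positive_cone_convex : is_convex positive_cone.
Proof.
move=> z1 z2 t t0 t1 C1 C2 b Ub; have s0 : 0 <= 1 - t by rewrite subr_ge0.
have := psiDr (t *: z1) ((1 - t) *: z2) (b * b); rewrite /psi => ->.
apply: addr_ge0; first exact: (positive_coneZ t0 C1 Ub).
exact: (positive_coneZ s0 C2 Ub).
Qed.

Lemma positive_cone_closed : norm_closed positive_cone.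
Proof.
move=> z Cz b Ub; apply/ler_addgt0Pr => e e0.
have D0 : 0 < 1 + `|x| * `|b * b| by rewrite ltr_wpDr// mulr_ge0.
have [|w Cw zw] := Cz (e / (1 + `|x| * `|b * b|)); first by rewrite divr_gt0.
have h0 : 0 <= psi w (b * b) by exact: Cw.
have h1 : psi (w - z) (b * b) <= e.
  rewrite (le_trans (psi_le _ _))// distrC.
  rewrite ler_pdivlMr// in zw; rewrite (le_trans _ zw)//.
  by rewrite mulrAC mulrC ler_wpM2l// lerDr.
move: h1; rewrite psiDr -scaleN1r psiZr mulN1r => h1.
by rewrite -/(psi z (b * b)); lra.
Qed.

(** By commutativity b b c c is the square of b c. *)
Lemma positive_cone_square z b : unitization A b -> positive_cone z ->
  positive_cone (adjoint (b * b) z).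
Proof.
move=> Ub Cz c Uc; have := psiM z (b * b) (c * c); rewrite /psi => ->.
rewrite (_ : b * b * (c * c) = (b * c) * (b * c)); last first.
  by rewrite -[RHS]mulrA [c * (b * c)]mulrA (unitization_commute algA Uc Ub) !mulrA.
by apply: Cz; exact: unitizationM.
Qed.

Let cauchy_schwarz z b c : positive_cone z -> unitization A b -> unitization A c ->
  psi z (b * c) ^+ 2 <= psi z (b * b) * psi z (c * c).
Proof.
move=> Cz Ub Uc; apply: nonneg_quadratic => [||t]; [exact: Cz|exact: Cz|].
have : 0 <= psi z ((b + t *: c) * (b + t *: c)).
  by apply: Cz; apply: unitizationD => //; exact: unitizationZ.
rewrite mulrDr !mulrDl -!bop_scaleAl -!bop_scaleAr.
rewrite (unitization_commute algA Uc Ub) !psiD !psiZ.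
by move=> h; apply: (le_trans h); rewrite le_eqVlt; apply/orP; left; apply/eqP; ring.
Qed.

(* Kaplansky's iteration of the Cauchy-Schwarz inequality. *)
Lemma positive_cone_sub_square z S : unitization A S -> positive_cone z ->
  positive_cone (adjoint (1 - ((1 + `|S|) ^+ 2)^-1 *: (S * S)) z).
Proof.
move=> US Cz b Ub; set s := 1 + `|S|.
have s0 : 0 < s by rewrite ltr_wpDr.
have USn n : unitization A (S ^+ n).
  elim: n => [|n ih]; first exact: unitization1.
  by rewrite exprS; exact: unitizationM.
have bS n : b * S ^+ n = S ^+ n * b by exact: (unitization_commute algA).
have h : psi z (b * b * S ^+ 2) <= psi z (b * b) * s ^+ 2.
  (* Cauchy-Schwarz for b and b S^(2^(n+1)) gives the quadratic recursion; the norm bound on [psi]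
     has rate |S|, and 1 + |S| is a strictly larger rate. *)
  have := @log_convex_bound R (psi z (b * b)) (`|x| * `|z| * `|b * b|) s `|S|
    (fun n => psi z (b * b * S ^+ (2 ^ n.+1))).
  apply.
  - exact: Cz.
  - by rewrite !mulr_ge0.
  - exact: normr_ge0.
  - by rewrite /s ltrDr.
  - move=> n; have := cauchy_schwarz Cz Ub (unitizationM algA Ub (USn (2 ^ n.+1)%N)).
    rewrite mulrA (_ : b * _ * (b * _) = b * b * S ^+ (2 ^ n.+2))//.
    rewrite (expnS 2 n.+1) mul2n -addnn exprD; set T := S ^+ _.
    by rewrite -[LHS]mulrA [T * (b * T)]mulrA -(bS (2 ^ n.+1)%N) !mulrA.
  - move=> n; rewrite (le_trans (psi_le _ _))// -[leRHS]mulrA ler_wpM2l ?mulr_ge0//.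
    by rewrite (le_trans (bop_normM _ _))// ler_wpM2l// bop_normX.
have := psiM z (1 - (s ^+ 2)^-1 *: (S * S)) (b * b); rewrite /psi => ->.
rewrite -/(psi z _) mulrBl mul1r -scaleN1r psiD psiZ -bop_scaleAl psiZ -expr2.
rewrite (_ : S ^+ 2 * (b * b) = b * b * S ^+ 2); last first.
  by rewrite -[RHS]mulrA bS [RHS]mulrA bS -mulrA.
have : (s ^+ 2)^-1 * psi z (b * b * S ^+ 2) <= psi z (b * b).
  by rewrite ler_pdivrMl ?exprn_gt0// mulrC.
by move=> h1; rewrite mulN1r subr_ge0.
Qed.

End PositiveCone.

(* The hypothesis dimX only excludes dimensions 0, 1, 2: there a nontrivial
   invariant subspace need not exist (for instance for the algebra generated by
   a rotation of the plane, whose elements all have essential norm 0). *)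
Theorem theorem3p1 (R : realType) (X : completeNormedModType R)
  (dimX : dim_ge X 3) (A : set (bop X X))
  (algA : commutative_algebra A)
  (realA : forall T, A T -> essentially_real T) :
  exists L : set (dual X),
    [/\ closed_subspace L, L <> [set 0%R], L <> setT &
        forall T, A T -> adjoint T @` L `<=` L].
Proof.
apply: contrapT => noinv; have [_ AL AM AC] := algA.
have [x [w [x0 w0 xw]]] := exists_positive_functional dimX algA noinv realA.
have AD S T : A S -> A T -> A (S + T) by exact: algebraD.
(* If (S S)^* w were 0 for all S in A, polarisation would give (S T)^* w = 0 for all S and T in
   A. *)
have [S AS Sw] : exists2 S, A S & adjoint (S * S) w <> 0.
  apply: contrapT => noS; apply: noinv.
  apply: (dual_invariant_of_annihilated dimX algA x0 w0) => S T AS AT.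
  have sq U : A U -> adjoint (U * U) w = 0.
    by move=> AU; apply: contrapT => Uw; apply: noS; exists U.
  have := sq _ (AD _ _ AS AT).
  rewrite mulrDl !mulrDr !adjointDl !sq// add0r addr0 (AC T S)// => h.
  suff -> : adjoint (S * T) w = 0 by rewrite linear0.
  by apply/eqP; move/eqP: h; rewrite -mulr2n -scaler_nat scaler_eq0 pnatr_eq0.
(* Positivity at w is known for squares from A only, while the cone tests squares from A + R 1.
   Replacing w by (S S)^* w repairs this, because A is an ideal of A + R 1 and so contains S b. *)
pose z0 := adjoint (S * S) w.
have Cz0 : positive_cone A x z0.
  move=> b Ub; rewrite -adjointM (_ : S * S * (b * b) = (S * b) ^+ 2).
    by apply: xw; exact: unitizationMl.
  by rewrite expr2 !mulrA; congr (_ * _); rewrite -!mulrA (unitization_commute_sub algA AS Ub).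
have [v v0 xv] := @dim_ge_kernel R (dual X) 3 1 (fun=> x) isT (dim_ge_dual dimX).
have [w2 [x2 [Cw2 w20 x20 x2C x2w2]]] := cone_support_point
  (@dual_cauchy_complete R X) (@positive_cone_closed R X A x)
  (@positive_cone_convex R X A x) (@positive_cone0 R X A x)
  (@positive_coneZ R X A x) (positive_cone_ge0 algA (x := x)) x0 Cz0 Sw v0 (xv ord0).
have x2sq T : A T -> x2 (adjoint (T * T) w2) = 0.
  move=> AT; have UT := sub_unitization AT.
  apply/eqP; rewrite eq_le; apply/andP; split; last first.
    exact: (x2C _ (positive_cone_square algA UT Cw2)).
  have := x2C _ (positive_cone_sub_square algA UT Cw2).
  rewrite adjointBl adjoint1 adjointZl (linearB x2) /= x2w2 linearZ /= sub0r oppr_ge0.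
  by rewrite pmulr_rle0// invr_gt0 exprn_gt0// ltr_wpDr.
apply: noinv; apply: (dual_invariant_of_annihilated dimX algA x20 w20).
move=> T U AT AU; have := x2sq _ (AD _ _ AT AU).
rewrite mulrDl !mulrDr !adjointDl !linearD /= !x2sq// add0r addr0 (AC U T)//.
by move/eqP; rewrite -mulr2n mulrn_eq0 => /eqP.
Qed.
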